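(* Let $h\in(0,\bar h]$. (i) For all $y\in(l_h,r_h)$ the right derivative $\partial_+\hat a_h(y)=\lim_{\varepsilon\searrow0}\frac{\hat a_h(y+\varepsilon)-\hat a_h(y)}{\varepsilon}$ and the left derivative $\partial_-\hat a_h(y)=\lim_{\varepsilon\searrow0}\frac{\hat a_h(y)-\hat a_h(y-\varepsilon)}{\varepsilon}$ exist, and $$\partial_+\hat a_h(y)=\frac{m((y-\hat a_h(y),y])-m((y,y+\hat a_h(y)])}{m((y-\hat a_h(y),y+\hat a_h(y)])},\qquad \partial_-\hat a_h(y)=\frac{m([y-\hat a_h(y),y))-m([y,y+\hat a_h(y)))}{m([y-\hat a_h(y),y+\hat a_h(y)))}.$$ Moreover, $\partial_+\hat a_h$ is càdlàg, $\partial_-\hat a_h$ is càglàd and, for all $y\in(l_h,r_h)$, $\lim_{\varepsilon\searrow0}\partial_+\hat a_h(y-\varepsilon)=\partial_-\hat a_h(y)$. In particular, there exists an at most countable set $\mathcal N\subset(l_h,r_h)$ such that the derivative $\hat a_h'$ exists on $(l_h,r_h)\setminus\mathcal N$ and, for all $y\in(l_h,r_h)\setminus\mathcal N$, $\hat a_h'(y)=\partial_+\hat a_h(y)=\partial_-\hat a_h(y)$. (ii) Let $\mathcal G=\{(y,a)\in(l_h,r_h)\times(0,\infty): y\pm a\in I^\circ\}$ and define $F\colon(l_h,r_h)\times(0,\infty)\to\mathbb R$ by $$F(y,a)=\frac{m((y-a,y])-m((y,y+a])}{m((y-a,y+a])}\ \text{ for }(y,a)\in\mathcal G,\qquad F(y,a)=0\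 \text{ for }(y,a)\notin\mathcal G.$$ Let $y_0\in(l_h,r_h)$ and let $a\colon(l_h,r_h)\to(0,\infty)$ be a function that is absolutely continuous on compact subintervals of $(l_h,r_h)$ and satisfies $a'(y)=F(y,a(y))$ for Lebesgue-almost all $y\in(l_h,r_h)$ and $a(y_0)=\hat a_h(y_0)$. Then $a(y)=\hat a_h(y)$ for all $y\in(l_h,r_h)$.
   Context: Let $Y=(Y_t)_{t\ge0}$ be a one-dimensional continuous strong Markov process (in the sense of Revuz--Yor, Section VII.3) with laws $(P_y)_{y\in I}$, $P_y[Y_0=y]=1$. Its state space $I\subseteq\mathbb R$ is an open, half-open or closed interval with interior $I^\circ=(l,r)$, $-\infty\le l<r\le\infty$; put $\bar I=[l,r]$. Let $H_x(Y)=\inf\{t\ge0:Y_t=x\}$. Standing assumptions: $Y$ is regular ($P_y[H_x(Y)<\infty]>0$ for all $y\in I^\circ$, $x\in I$), conservative (infinite life time) and in natural scale. Let $m$ be the speed measure of $Y$ on $I^\circ$ (normalized so that Brownian motion has $m(dx)=2\,dx$); recall that $0<m([a,b])<\infty$ for all $a<b$ in $I^\circ$. A boundary point $b\in\{l,r\}$ is called accessible if $P_y[H_b(Y)<\infty]>0$ for some (equivalently all) $y\in I^\circ$; $b$ is accessible if and only if $b\in I$, and accessible boundary points are assumed absorbing. By Feller's test, $l\in I$ if and only if $l>-\infty$ and $\int_{(l,y)}(u-l)\,m(du)<\infty$ for some (equivalently all) $y\in I^\circ$, and symmetrically for $r$. Fix $\bar h\in(0,\infty)$. For $h\in(0,\bar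 h]$ the EMCEL scale factor $\hat a_h\colon\bar I\to[0,\infty)$ is defined by $\hat a_h(l)=\hat a_h(r)=0$ and, for $y\in I^\circ$, $$\hat a_h(y)=\sup\Big\{a\ge0:\ y\pm a\in I\ \text{ and }\ \tfrac12\int_{(y-a,y+a)}(a-|u-y|)\,m(du)\le h\Big\}.$$ For $h\in(0,\bar h]$: if $l>-\infty$, set $$l_h=l+\inf\Big\{a\in\big(0,\tfrac{r-l}2\big]: a<\infty\ \text{and}\ \tfrac12\int_{(l,l+2a)}(a-|u-(l+a)|)\,m(du)\ge h\Big\},$$ with $\inf\emptyset=\frac{r-l}2$; if $l=-\infty$, set $l_h=-\infty$. If $r<\infty$, set $$r_h=r-\inf\Big\{a\in\big(0,\tfrac{r-l}2\big]: a<\infty\ \text{and}\ \tfrac12\int_{(r-2a,r)}(a-|u-(r-a)|)\,m(du)\ge h\Big\},$$ with the same convention; if $r=\infty$, set $r_h=\infty$. (For $y\in(l_h,r_h)$ one has $y\pm\hat a_h(y)\in I^\circ$ and $\hat a_h(y)$ is the unique positive root $a$ of $\frac12\int_{(y-a,y+a)}(a-|u-y|)\,m(du)=h$.) *)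

(* Defs.v *)
From HB Require Import structures.
From mathcomp Require Import all_boot all_order all_algebra.
From mathcomp Require Import all_classical all_reals all_analysis.
From mathcomp Require Import measurable_realfun.

Set Implicit Arguments.
Unset Strict Implicit.
Unset Printing Implicit Defensive.
Import Order.TTheory GRing.Theory Num.Theory.
Import numFieldNormedType.Exports.

Local Open Scope classical_set_scope.
Local Open Scope ring_scope.
Local Open Scope ereal_scope.

Definition ointv {R : realType} (l r : \bar R) : set R :=
  [set y | l < y%:E /\ y%:E < r].

(* [I] is an open, half-open or closed interval with interior (l, r); an
   infinite end point is never an element of [I]. *)
Definition state_space {R : realType} (l r : \bar R) (I : set R) : Prop :=
  [/\ l < r, is_interval I & interior I = ointv l r].

(* Time is indexed by [R]; only the times t >= 0 matter. *)

Definition hitting_time {R : realType} {Omega : Type} (Y : R -> Omega -> R)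
    (x : R) (w : Omega) : \bar R :=
  ereal_inf [set t%:E | t in [set t : R | (0 <= t)%R /\ Y t w = x]].

Definition stopping_time {R : realType} {Omega : Type}
    (Filt : R -> set (set Omega)) (tau : Omega -> \bar R) : Prop :=
  (forall w, 0 <= tau w) /\
  (forall t : R, (0 <= t)%R -> Filt t [set w | tau w <= t%:E]).

Definition stopped_events {R : realType} {d : measure_display}
    {Omega : measurableType d} (Filt : R -> set (set Omega))
    (tau : Omega -> \bar R) : set (set Omega) :=
  [set A | measurable A /\
    forall t : R, (0 <= t)%R -> Filt t (A `&` [set w | tau w <= t%:E])].

(* Conservativeness (infinite life time) is part of the definition: the
   process is defined at all times t >= 0 and never leaves [I].  The field
   [csm_strong_markov] is the strong Markov property
     P_y[Y_{tau + t} \in B | F_tau] = P_{Y_tau}[Y_t \in B]  on {tau < oo}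
   for every stopping time [tau], possibly infinite, written as an identity of
   integrals over the events of F_tau. *)
Record continuous_strong_markov {R : realType} {d : measure_display}
    {Omega : measurableType d} (I : set R) (P : R -> probability Omega R)
    (Filt : R -> set (set Omega)) (Y : R -> Omega -> R) : Prop := {
  csm_filtration_sigma : forall t : R, (0 <= t)%R ->
    sigma_algebra setT (Filt t) /\ Filt t `<=` measurable;
  csm_filtration_mono : forall s t : R, (0 <= s)%R -> (s <= t)%R ->
    Filt s `<=` Filt t;
  csm_adapted : forall (t : R) (B : set R), (0 <= t)%R -> measurable B ->
    Filt t (Y t @^-1` B);
  csm_state : forall (t : R) (w : Omega), (0 <= t)%R -> I (Y t w);
  csm_continuous : forall w : Omega,
    {within `[0%R, +oo[, continuous (fun t : R => Y t w)};
  csm_start : forall y : R, I y -> P y [set w | Y 0%R w = y] = 1;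
  csm_kernel : forall (t : R) (B : set R), (0 <= t)%R -> measurable B ->
    measurable_fun I (fun y : R => P y (Y t @^-1` B));
  csm_strong_markov : forall (y : R) (tau : Omega -> \bar R) (A : set Omega)
      (t : R) (B : set R),
    I y -> stopping_time Filt tau -> stopped_events Filt tau A ->
    (0 <= t)%R -> measurable B ->
    P y (A `&` [set w | tau w < +oo] `&`
           [set w | B (Y (fine (tau w) + t)%R w)]) =
    \int[P y]_(w in A `&` [set w | tau w < +oo])
       P (Y (fine (tau w)) w) (Y t @^-1` B)
}.

Definition regular_process {R : realType} {d : measure_display}
    {Omega : measurableType d} (I : set R) (P : R -> probability Omega R)
    (Y : R -> Omega -> R) : Prop :=
  forall y x : R, interior I y -> I x ->
    0 < P y [set w | hitting_time Y x w < +oo].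

Definition natural_scale {R : realType} {d : measure_display}
    {Omega : measurableType d} (I : set R) (P : R -> probability Omega R)
    (Y : R -> Omega -> R) : Prop :=
  forall a y b : R, I a -> I b -> (a < y)%R -> (y < b)%R ->
    P y [set w | hitting_time Y b w < hitting_time Y a w] =
    ((y - a) / (b - a))%:E.

Definition accessible {R : realType} {d : measure_display}
    {Omega : measurableType d} (I : set R) (P : R -> probability Omega R)
    (Y : R -> Omega -> R) (b : R) : Prop :=
  exists y : R, interior I y /\ 0 < P y [set w | hitting_time Y b w < +oo].

Definition absorbing_boundary {R : realType} {d : measure_display}
    {Omega : measurableType d} (l r : \bar R) (I : set R)
    (P : R -> probability Omega R) (Y : R -> Omega -> R) : Prop :=
  forall b : R, b%:E = l \/ b%:E = r -> accessible I P Y b ->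
    P b [set w | forall t : R, (0 <= t)%R -> Y t w = b] = 1.

Definition green {R : realType} (a b y u : R) : R :=
  ((Num.min y u - a) * (b - Num.max y u) / (b - a))%R.

(* Speed measure of a process in natural scale, on the interior of [I]: the
   values of [m] on sets not included in the interior of [I] are irrelevant.
   With this Green function, Brownian motion has m(dx) = 2 dx. *)
Definition speed_measure {R : realType} {d : measure_display}
    {Omega : measurableType d} (I : set R) (P : R -> probability Omega R)
    (Y : R -> Omega -> R)
    (m : {measure set (measurableTypeR R) -> \bar R}) : Prop :=
  (forall a b : R, interior I a -> interior I b -> (a < b)%R ->
     0 < m `[a, b]%classic /\ m `[a, b]%classic < +oo) /\
  (forall a y b : R, I a -> I b -> (a < y)%R -> (y < b)%R ->
     \int[P y]_w Order.min (hitting_time Y a w) (hitting_time Y b w) =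
     \int[m]_(u in `]a, b[%classic) (green a b y u)%:E).

Definition tent_integral {R : realType}
    (m : {measure set (measurableTypeR R) -> \bar R}) (y a : R) : \bar R :=
  (2^-1)%:E * \int[m]_(u in `](y - a)%R, (y + a)%R[%classic)
    (a - `|u - y|)%:E.

(* The EMCEL scale factor; it is 0 at the end points, and (by convention)
   outside of the closure of [I]. *)
Definition scale_factor {R : realType} (I : set R)
    (m : {measure set (measurableTypeR R) -> \bar R}) (h y : R) : R :=
  if `[< interior I y >] then
    sup [set a : R | [/\ (0 <= a)%R, I (y - a)%R, I (y + a)%R
                       & tent_integral m y a <= h%:E]]
  else 0%R.

Definition inf_or {R : realType} (x : \bar R) (A : set R) : \bar R :=
  if `[< A = set0 >] then x else ereal_inf [set a%:E | a in A].

Definition lower_cut {R : realType} (l r : \bar R)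
    (m : {measure set (measurableTypeR R) -> \bar R}) (h : R) : \bar R :=
  if l is l0%:E then
    l + inf_or ((r - l) * (2^-1)%:E)
          [set a : R | [/\ (0 < a)%R, a%:E <= (r - l) * (2^-1)%:E
                         & h%:E <= tent_integral m (l0 + a)%R a]]
  else l.

Definition upper_cut {R : realType} (l r : \bar R)
    (m : {measure set (measurableTypeR R) -> \bar R}) (h : R) : \bar R :=
  if r is r0%:E then
    r - inf_or ((r - l) * (2^-1)%:E)
          [set a : R | [/\ (0 < a)%R, a%:E <= (r - l) * (2^-1)%:E
                         & h%:E <= tent_integral m (r0 - a)%R a]]
  else r.

Definition cut_interval {R : realType} (l r : \bar R)
    (m : {measure set (measurableTypeR R) -> \bar R}) (h : R) : set R :=
  ointv (lower_cut l r m h) (upper_cut l r m h).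

Local Close Scope ereal_scope.

Definition right_quotient {R : realType} (f : R -> R) (y e : R) : R :=
  (f (y + e) - f y) / e.

Definition left_quotient {R : realType} (f : R -> R) (y e : R) : R :=
  (f y - f (y - e)) / e.

Definition right_derivative {R : realType} (f : R -> R) (y : R) : R :=
  lim (right_quotient f y e @[e --> 0^'+]).

Definition left_derivative {R : realType} (f : R -> R) (y : R) : R :=
  lim (left_quotient f y e @[e --> 0^'+]).

Definition cadlag_on {R : realType} (J : set R) (f : R -> R) : Prop :=
  forall y, J y -> f x @[x --> y^'+] --> f y /\ cvg (f x @[x --> y^'-]).

Definition caglad_on {R : realType} (J : set R) (f : R -> R) : Prop :=
  forall y, J y -> f x @[x --> y^'-] --> f y /\ cvg (f x @[x --> y^'+]).

Definition right_slope {R : realType}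
    (m : {measure set (measurableTypeR R) -> \bar R}) (y a : R) : R :=
  (fine (m `](y - a), y]%classic) - fine (m `]y, (y + a)]%classic))
    / fine (m `](y - a), (y + a)]%classic).

Definition left_slope {R : realType}
    (m : {measure set (measurableTypeR R) -> \bar R}) (y a : R) : R :=
  (fine (m `[(y - a), y[%classic) - fine (m `[y, (y + a)[%classic))
    / fine (m `[(y - a), (y + a)[%classic).

Definition good_pairs {R : realType} (l r : \bar R) (I : set R)
    (m : {measure set (measurableTypeR R) -> \bar R}) (h : R) : set (R * R) :=
  [set p | [/\ cut_interval l r m h p.1, 0 < p.2,
               interior I (p.1 - p.2) & interior I (p.1 + p.2)]].

Definition ode_field {R : realType} (l r : \bar R) (I : set R)
    (m : {measure set (measurableTypeR R) -> \bar R}) (h y a : R) : R :=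
  if `[< good_pairs l r I m h (y, a) >] then right_slope m y a else 0.

Definition absolutely_continuous {R : realType} (c d : R) (f : R -> R) : Prop :=
  forall eps : R, 0 < eps -> exists2 delta : R, 0 < delta &
    forall (n : nat) (s t : 'I_n -> R),
      (forall i, [/\ c <= s i, s i <= t i & t i <= d]) ->
      trivIset setT (fun i => `]s i, t i[%classic) ->
      \sum_(i < n) (t i - s i) < delta ->
      \sum_(i < n) `|f (t i) - f (s i)| < eps.

(* Main.v *)
Require Import Defs.
From HB Require Import structures.
From mathcomp Require Import all_boot all_order all_algebra.
From mathcomp Require Import all_classical all_reals all_analysis.
From mathcomp Require Import measurable_realfun.
From mathcomp Require Import lra ring.

Set Implicit Arguments.
Unset Strict Implicit.
Unset Printing Implicit Defensive.
Import Order.TTheory GRing.Theory Num.Theory.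
Import numFieldNormedType.Exports.
Local Open Scope classical_set_scope.
Local Open Scope ring_scope.
(* If [pot] is a second antiderivative of [m], the tent integral at [(y, a)] is
   [(pot (y + a) + pot (y - a) - 2 * pot y) / 2]; hence the scale factor
   [a_h y] is the root [a] of [pot (y + a) + pot (y - a) - 2 * pot y = 2 * h].
   Comparing tents shows that [y + a_h y] and [y - a_h y] are strictly
   increasing.  Expanding the equation to first order along [y + e], with the
   one-sided derivatives of [pot] at [y + a_h y], [y - a_h y] and [y], gives the
   one-sided derivatives of [a_h], and their one-sided limits follow from those
   of the distribution function of [m].  They differ only if one of the three
   points is an atom of [m], which happens for countably many [y].

   For a solution [a] of the ODE, [|a'| <= 1], so [y + a y] and [y - a y] are
   nondecreasing; the same expansion shows that
   [pot (y + a y) + pot (y - a y) - 2 * pot y] is absolutely continuous with zero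
   right derivative almost everywhere.  It is thus locally constant, so that the
   set where [a = a_h] is open and closed in the cut interval. *)

(** * Monotonicity of absolutely continuous functions *)

(** [pot] has a kink at every atom of [m], so the chain rule fails. It is replaced by a comparison
    of tents: a tent lies under another as soon as its half-width is smaller by at least the
    distance of the centres. This makes [a_h] 1-Lipschitz, so a step of [y] to the right never moves
    [y + a_h y] or [y - a_h y] to the left, and right derivatives of [pot] are enough for the
    expansion. For a solution of the ODE the bound on [F] has the same effect. [m] may have infinite
    mass near the ends of [I]. Hence [pot] lives on a compact window [[A, B]] in the interior,
    chosen anew around each point; only the tent integral, whose value does not depend on the
    window, is compared between points. The cuts [l_h] and [r_h] ensure that some tent with both
    feet in the interior has integral above [h]: the supremum defining [a_h] is then stopped by the
    equation and not by the boundary of [I]. *)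

Section ac_monotone.
Context {R : realType} (c d : R) (g : R -> R).

(** The definition of absolute continuity for a single interval. The left side suffices, since the
    lemma serves at a supremum, which is approached from the left. *)
Lemma ac_left_continuous (x : R) :
  absolutely_continuous c d g ->
  c <= x <= d -> forall eps : R, 0 < eps -> exists2 del : R, 0 < del &
    forall y, c <= y -> y <= x -> x - y < del -> `|g x - g y| < eps.
Proof.
move=> gac /andP[cx xd] eps eps0; have [del del0 H] := gac eps eps0.
exists del => // y cy yx xy.
have := H 1%N (fun=> y) (fun=> x).
rewrite !big_ord1; apply => //.
apply/trivIsetP => i j _ _; by rewrite !ord1 eqxx.
Qed.

(** Confining the intervals to [U] lets the small measure of [U] bound all these sums at once. *)
Definition variation_sums (U : set R) (x : R) : set R :=
  [set v | exists (n : nat) (s t : 'I_n -> R),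
    [/\ forall i, [/\ c <= s i, s i <= t i & t i <= x],
        trivIset setT (fun i => `]s i, t i[%classic),
        forall i, `]s i, t i[%classic `<=` U &
        v = \sum_(i < n) `|g (t i) - g (s i)| ] ].

Lemma variation_sums0 U x : variation_sums U x 0.
Proof.
exists 0%N, (fun=> 0), (fun=> 0); split; rewrite ?big_ord0//; try by case.

Qed.

Lemma variation_sums_cons U x x' v : c <= x -> x <= x' ->
  `]x, x'[%classic `<=` U ->
  variation_sums U x v -> variation_sums U x' (`|g x' - g x| + v).
Proof.
move=> cx xx' xU [n [s [t [H1 H2 H3 ->]]]].
(* Index [ord0] carries the new interval; [unlift ord0] sends the other indices back to the old
   family. *)
pose s' (i : 'I_n.+1) := oapp s x (unlift ord0 i).
pose t' (i : 'I_n.+1) := oapp t x' (unlift ord0 i).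
have E0 : s' ord0 = x /\ t' ord0 = x' by rewrite /s' /t' unlift_none.
have EL i : s' (lift ord0 i) = s i /\ t' (lift ord0 i) = t i.
  by rewrite /s' /t' liftK.
exists n.+1, s', t'; split.
- move=> i; case: (unliftP ord0 i) => [j|] ->.
    have [-> ->] := EL j; have [? ? ?] := H1 j; split => //; lra.
  by have [-> ->] := E0.
- have D j : `]x, x'[%classic `&` `]s j, t j[%classic = set0.
    rewrite -subset0 => z /=; rewrite !in_itv/= => -[/andP[? ?] /andP[? ?]].
    by have [? ? ?] := H1 j; lra.
  apply/trivIsetP => i j _ _.
  case: (unliftP ord0 i) => [i'|] ->; case: (unliftP ord0 j) => [j'|] ->.
  + have [-> ->] := EL i'; have [-> ->] := EL j' => ij.
    move/trivIsetP : H2; apply => //; apply: contra ij => /eqP ->//.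
  + by have [-> ->] := EL i'; have [-> ->] := E0; rewrite setIC D.
  + by have [-> ->] := EL j'; have [-> ->] := E0; rewrite D.
  + by rewrite eqxx.
- move=> i; case: (unliftP ord0 i) => [j|] ->.
    by have [-> ->] := EL j; exact: H3.
  by have [-> ->] := E0.
- rewrite big_ord_recl; have [-> ->] := E0; congr (_ + _).
  by apply: eq_bigr => i _; have [-> ->] := EL i.
Qed.

Lemma sum_length_le (U : set R) (n : nat) (s t : 'I_n -> R) : measurable U ->
  (forall i, s i <= t i) -> trivIset setT (fun i => `]s i, t i[%classic) ->
  (forall i, `]s i, t i[%classic `<=` U) ->
  ((\sum_(i < n) (t i - s i))%:E <= lebesgue_measure U)%E.
Proof.
move=> mU st tI sU.
have -> : (\sum_(i < n) (t i - s i))%:E =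
    (\sum_(i < n) lebesgue_measure (`]s i, t i[%classic : set R))%E.
  rewrite -sumEFin; apply: eq_bigr => i _.
  rewrite lebesgue_measure_itv/= lte_fin; case: ltP => // ts.
  by have -> : t i = s i by [have := st i; lra]; rewrite subrr.
rewrite -measure_semi_additive_ord//.
  apply: le_measure; rewrite ?inE//.
    by apply: bigsetU_measurable => i _.
  by apply: (big_ind (fun A : set R => A `<=` U)) => // A B AU BU; rewrite subUset.
by apply: bigsetU_measurable => i _.
Qed.


Let mu : measure _ _ := @lebesgue_measure R.

(* Real induction on [x |-> g c - eps * (x - c) - V x <= g x], where [V x] is
   the largest variation of [g] over disjoint intervals in [c, x] included in a
   small open set containing the exceptional null set. *)
Lemma ac_dini_nondecreasing : c <= d -> absolutely_continuous c d g ->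
  {ae mu, forall x, c <= x < d -> forall eps, 0 < eps ->
     \forall e \near 0^'+, - eps * e <= g (x + e) - g x} ->
  g c <= g d.
Proof.
move=> cd gac [N [mN N0 badN]].
apply/ler_addgt0Pr => eps0 eps00.
(* At [d] the loss is at most [eps * (d - c)] from the linear term plus [eps] from [V d], together
   [eps0]. *)
pose eps := eps0 / (d - c + 1).
have dc1 : 0 < d - c + 1 by lra.
have eps_gt0 : 0 < eps by rewrite divr_gt0.
have [del del0 H] := gac eps eps_gt0.
have muN : (mu N < +oo)%E by rewrite N0.
have [U [oU NU UN]] := lebesgue_regularity_outer mN muN del0.
have mU : measurable U by exact: open_measurable.
have muU : (mu U < del%:E)%E.
  have := measureDI mu mU mN.
  by rewrite (setIidr NU) [X in (_ + X)%E]N0 adde0 => ->.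
pose W := variation_sums U.
have Wub x : x <= d -> ubound (W x) eps.
  move=> xd v [n [s [t [H1 H2 H3 ->]]]].
  apply/ltW/H => //.
    by move=> i; have [? ? ?] := H1 i; split => //; lra.
  rewrite -lte_fin; apply: le_lt_trans muU.
  by apply: sum_length_le => // i; have [] := H1 i.
have WU x : x <= d -> has_ubound (W x) by move=> xd; exists eps; exact: Wub.
have Wne x : W x !=set0 by exists 0; exact: variation_sums0.
pose V x := sup (W x).
have Veps x : x <= d -> V x <= eps by move=> xd; apply: ge_sup => //; exact: Wub.
have Vstep x x' : c <= x -> x <= x' -> x' <= d -> `]x, x'[%classic `<=` U ->
    `|g x' - g x| + V x <= V x'.
  move=> cx xx' x'd xU; rewrite addrC -lerBrDr; apply: ge_sup => // v Wv.
  rewrite lerBrDr addrC; apply: ub_le_sup; first exact: WU.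
  exact: variation_sums_cons Wv.
have Vmono x x' : x <= x' -> x' <= d -> V x <= V x'.
  move=> xx' x'd; apply: ge_sup => // v [n [s [t [H1 H2 H3 ->]]]].
  apply: ub_le_sup; first exact: WU.
  exists n, s, t; split => // i; have [? ? ?] := H1 i; split => //; lra.
pose Q x := g c - eps * (x - c) - V x <= g x.
pose S := [set x | [/\ c <= x, x <= d & Q x]].
have Sc : S c.
  split => //; rewrite /Q subrr mulr0 subr0 lerBlDr lerDl.
  by apply: ub_le_sup; [exact: WU|exact: variation_sums0].
have Sub : has_ubound S by exists d => x [].
have hS : has_sup S by split => //; exists c.
have cs : c <= sup S by exact: ub_le_sup.
have sd : sup S <= d by apply: ge_sup => [|x []//]; exists c.
set z := sup S in cs sd *.
have Sz : S z.
  split => //; rewrite /Q; apply/ler_addgt0Pr => eta eta0.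
  have [|del' del'0 Hd] := ac_left_continuous gac (x := z) _ eta0.
    by rewrite cs sd.
  have [x Sx zx] := sup_adherent del'0 hS.
  have xz : x <= z by exact: ub_le_sup.
  case: Sx => cx xd Qx.
  have := Hd x cx xz; rewrite -/z in zx; rewrite ltrBlDr -ltrBlDl zx => /(_ isT).
  have := Vmono x z xz sd; move: Qx; rewrite /Q.
  have : eps * (x - c) <= eps * (z - c) by apply: ler_wpM2l; lra.
  by rewrite ltr_norml => ? ? ? /andP[? ?]; lra.
have zd : z = d.
  apply/eqP; rewrite eq_le sd/= leNgt; apply/negP => zd.
  suff [x' [zx' x'd Qx']] : exists x', [/\ z < x', x' <= d & Q x'].
    have : x' <= z by apply: ub_le_sup => //; split => //; lra.
    lra.
  case: Sz => _ _; rewrite /Q => Qz.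
  (* Inside [U] nothing is known of the derivative, but a drop of [g] is paid for by an equal growth
     of [V]. Outside [U], hence off the null set, the lower bound on the increments lets the linear
     term pay. *)
  have [Uz|nUz] := pselect (U z).
    have : nbhs z U by exact: open_nbhs_nbhs.
    move=> /nbhs_ballP[r/= r0 rU].
    pose x' := Num.min d (z + r / 2).
    have zx' : z < x' by rewrite lt_min zd/=; lra.
    have x'd : x' <= d by rewrite ge_min lexx.
    exists x'; split => //.
    have := Vstep z x' cs (ltW zx') x'd.
    have zU : `]z, x'[%classic `<=` U.
      move=> u/=; rewrite in_itv/= => /andP[zu ux']; apply: rU.
      have : x' <= z + r / 2 by rewrite ge_min lexx orbT.
      rewrite /ball/= ltr_norml => ?; apply/andP; split; lra.
    move=> /(_ zU).
    have : eps * (z - c) <= eps * (x' - c) by apply: ler_wpM2l; lra.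
    have := ler_norm (g z - g x'); rewrite distrC.
    lra.
  have good : forall e0, 0 < e0 ->
      \forall e \near 0^'+, - e0 * e <= g (z + e) - g z.
    have : ~ N z by move=> /NU.
    move=> nNz; apply: contrapT => bad; apply/nNz/badN => /= h; apply: bad.
    by apply: h; rewrite cs zd.
  have : \forall e \near (0:R)^'+, [/\ - eps * e <= g (z + e) - g z, 0 < e & e <= d - z].
    near=> e; split; near: e.
    - exact: good.
    - exact: nbhs_right_gt.
    - by apply: nbhs_right_le; lra.
  move=> /filter_ex[e [ge e0 ed]].
  exists (z + e); split; [lra|lra|].
  have := Vmono z (z + e); rewrite lerDl (ltW e0) => /(_ isT) H1.
  have {}H1 : V z <= V (z + e) by apply: H1; lra.
  rewrite /Q; have -> : eps * (z + e - c) = eps * (z - c) + eps * e by ring.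
  rewrite mulNr in ge.
  lra.
case: Sz; rewrite zd /Q => _ _ Qd.
have := Veps d (lexx _).
have : eps * (d - c + 1) = eps0 by rewrite /eps divfK// gt_eqF.
rewrite mulrDr mulr1.
lra.
Unshelve. all: by end_near. Qed.

End ac_monotone.
(** * Tents and the speed measure *)

Section tents.
Context {R : realType} (m : {measure set (measurableTypeR R) -> \bar R}).
Implicit Types y a u x z : R.

Definition tent y a u : R := Num.max 0 (a - `|u - y|).

Lemma tent_ge0 y a u : 0 <= tent y a u.
Proof. by rewrite le_max lexx. Qed.

Lemma tent_le y a y' a' u : `|y - y'| <= a' - a -> tent y a u <= tent y' a' u.
Proof.
move=> yy'; rewrite /tent; have := ler_distD y u y'.
rewrite ge_max !le_max lexx/= => ?; apply/orP; right; lra.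
Qed.

Lemma measurable_tent (D : set (measurableTypeR R)) y a :
  measurable_fun D (tent y a).
Proof.
apply: (@measurable_maxr _ _ _ D (cst 0) (fun u => a - `|u - y|)) => //.
apply: measurable_funB => //; apply: measurableT_comp => //.
by apply: measurable_funB.
Qed.

Lemma measurable_tentE (D : set (measurableTypeR R)) y a :
  measurable_fun D (fun u => (tent y a u)%:E).
Proof. by apply/measurable_EFinP; exact: measurable_tent. Qed.

Lemma tent_integralE y a :
  tent_integral m y a = ((2^-1)%:E * \int[m]_u (tent y a u)%:E)%E.
Proof.
rewrite /tent_integral; congr (_ * _)%E; rewrite integral_mkcond.
apply: eq_integral => u _; rewrite patchE/= /tent; case: ifPn.
  rewrite inE/= in_itv/= => /andP[? ?]; rewrite max_r//.
  by have : `|u - y| < a by [rewrite ltr_norml; apply/andP; split; lra]; lra.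
move=> /negP yu; rewrite max_l// leNgt; apply/negP => h; apply: yu.
have : `|u - y| < a by lra.
rewrite inE/= in_itv/= ltr_norml => /andP[? ?]; apply/andP; split; lra.
Qed.

Lemma tent_integral_gt (h : R) y a :
  (h%:E < tent_integral m y a)%E =
  ((2 * h)%:E < \int[m]_u (tent y a u)%:E)%E.
Proof. by rewrite tent_integralE lte_pdivlMl// EFinM. Qed.

Lemma le_tent_integral y a y' a' : `|y - y'| <= a' - a ->
  (tent_integral m y a <= tent_integral m y' a')%E.
Proof.
move=> h; rewrite !tent_integralE lee_pmul2l//.
apply: ge0_le_integral => //.
- by move=> u _; rewrite lee_fin tent_ge0.
- exact: measurable_tentE.
- exact: measurable_tentE.
- by move=> u _; rewrite lee_fin tent_le.
Qed.

(** Monotone convergence along [b - b / (n + 1)]. The integral at [b] may be infinite, as can happen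
    for a tent with a foot at an end point of [I]. *)
Lemma tent_integral_lsc (h y b : R) : 0 < b ->
  (h%:E < tent_integral m y b)%E ->
  exists a, [/\ 0 <= a, a < b & (h%:E < tent_integral m y a)%E].
Proof.
move=> b0; rewrite tent_integral_gt => hb.
pose an (n : nat) := b - b * n.+1%:R^-1.
have an0 n : 0 <= an n.
  by rewrite subr_ge0 ler_piMr ?(ltW b0)// invf_le1// ler1n.
have anb n : an n < b by rewrite gtrBl mulr_gt0.
have anS n k : (n <= k)%N -> an n <= an k.
  move=> nk; rewrite lerD2l lerN2 ler_wpM2l ?(ltW b0)//.
  by rewrite lef_pV2 ?posrE// ler_nat ltnS.
apply: contrapT => noa.
have le2h n : (\int[m]_u (tent y (an n) u)%:E <= (2 * h)%:E)%E.
  rewrite leNgt -tent_integral_gt; apply/negP => ?; apply: noa.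
  by exists (an n).
have mt n : measurable_fun setT (fun u => (tent y (an n) u)%:E).
  exact: measurable_tentE.
have := @cvg_monotone_convergence _ _ _ m setT measurableT
  (fun n u => (tent y (an n) u)%:E) mt.
have t0 n u : [set: R] u -> (0 <= (tent y (an n) u)%:E)%E.
  by rewrite lee_fin tent_ge0.
have tS u : [set: R] u -> {homo (fun n => (tent y (an n) u)%:E) : n k /
    (n <= k)%N >-> (n <= k)%E}.
  move=> _ n k nk; rewrite lee_fin; apply: tent_le.
  by rewrite subrr normr0; have := anS _ _ nk; lra.
move=> /(_ t0 tS).
have limE u : limn (fun n => (tent y (an n) u)%:E) = (tent y b u)%:E.
  apply/cvg_lim => //; apply/fine_cvgP; split; first exact: nearW.
  apply/cvgrPdist_le => e e0.
  have : (fun n => b * n.+1%:R^-1) @ \oo --> b * 0.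
    by apply: cvgM; [exact: cvg_cst|exact: cvg_harmonic].
  rewrite mulr0 => /cvgrPdist_le/(_ _ e0).
  apply: filterS => n /=; rewrite sub0r normrN => be.
  have be' := le_trans (ler_norm _) be.
  have t1 : tent y (an n) u <= tent y b u.
    by apply: tent_le; rewrite subrr normr0; have := anb n; lra.
  have t2 : tent y b u <= tent y (an n) u + e.
    rewrite /tent ge_max; apply/andP; split.
      by rewrite addr_ge0 ?tent_ge0// ltW.
    rewrite -lerBlDr le_max; apply/orP; right.
    rewrite /an; move: be'; set t := b / _ => be'.
    rewrite lerBlDr -addrA (addrC _ e) addrA lerD2r.
    by rewrite -addrA lerDl addrC subr_ge0.
  rewrite ger0_norm; lra.
under eq_integral do rewrite limE.
move=> cv; have : (\int[m]_u (tent y b u)%:E <= (2 * h)%:E)%E.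
  rewrite -(cvg_lim _ cv)//; apply: lime_le; last exact: nearW.
  by apply/cvg_ex; eexists; exact: cv.
by rewrite leNgt hb.
Qed.

(** Isolates the local properties of the speed measure that the analysis rests on. [O] is used both
    as [interior I] and as [ointv l r]. *)
Definition speed_like (O : set R) := [/\ open O, is_interval O &
  forall a b : R, O a -> O b -> a < b ->
    (0 < m `[a, b]%classic)%E /\ (m `[a, b]%classic < +oo)%E].

Lemma open_window (O : set R) x : open O -> O x ->
  exists2 e : R, 0 < e & forall z, `|z - x| <= e -> O z.
Proof.
move=> oO Ox; have : nbhs x O by exact: open_nbhs_nbhs.
move=> /nbhs_ballP[e /= e0 eO]; exists (e / 2); first by rewrite divr_gt0.
move=> z ze; apply: eO; rewrite /ball/= distrC.
by apply: le_lt_trans ze _; lra.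
Qed.

(** The second tent lies above the first everywhere, and by a margin [c] on a compact neighbourhood
    [K] of its apex, which has positive mass. *)
Lemma tent_integral_strict (O : set R) (h : R) y a y' a' : speed_like O ->
  O y' -> 0 <= a -> a < a' -> `|y - y'| <= a' - a ->
  (h%:E <= tent_integral m y a)%E -> (h%:E < tent_integral m y' a')%E.
Proof.
move=> [oO _ hm] Oy' a0 aa' yy' hG.
have [e e0 eO] := open_window oO Oy'.
(* On [K] the first tent is at most [a] and the second at least [a' - n], so the gap is at least
   [3 / 4 * (a' - a)], which exceeds [c]. *)
pose n := Num.min e ((a' - a) / 4).
have n0 : 0 < n by rewrite lt_min e0/=; lra.
have ne : n <= e by rewrite ge_min lexx.
have na : n <= (a' - a) / 4 by rewrite ge_min lexx orbT.
have On1 : O (y' - n) by apply: eO; rewrite addrAC subrr sub0r normrN gtr0_norm.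
have On2 : O (y' + n) by apply: eO; rewrite addrAC subrr add0r gtr0_norm.
pose K : set R := `[y' - n, y' + n]%classic.
have mK : measurable (K : set (measurableTypeR R)) by exact: measurable_itv.
have mI (D : set (measurableTypeR R)) : measurable_fun D (\1_K : _ -> R) by exact: measurable_indic.
have [K0 Koo] : (0 < m K)%E /\ (m K < +oo)%E by apply: hm => //; lra.
pose c := (a' - a) / 2.
have c0 : 0 < c by rewrite /c; lra.
have le1 : (\int[m]_u ((tent y a u)%:E + (c * \1_K u)%:E) <=
    \int[m]_u (tent y' a' u)%:E)%E.
  apply: ge0_le_integral => //.
  - move=> u _; rewrite -EFinD lee_fin addr_ge0 ?tent_ge0//.
    by rewrite mulr_ge0// ltW.
  - apply: emeasurable_funD; first exact: measurable_tentE.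
    apply/measurable_EFinP; exact: measurable_funM.
  - exact: measurable_tentE.
  - move=> u _; rewrite -EFinD lee_fin indicE.
    case: (boolP (u \in K)) => uK; last first.
      by rewrite mulr0 addr0; exact: tent_le.
    rewrite mulr1; move: uK; rewrite /K inE/= in_itv/= => /andP[uK1 uK2].
    have un : `|u - y'| <= n by rewrite ler_norml; apply/andP; split; lra.
    have ta : tent y a u <= a.
      by rewrite /tent ge_max a0/=; have := normr_ge0 (u - y); lra.
    have ta' : a' - n <= tent y' a' u.
      by rewrite /tent le_max; apply/orP; right; lra.
    rewrite /c; lra.
move: le1; rewrite ge0_integralD//; last 4 first.
- by move=> u _; rewrite lee_fin tent_ge0.
- exact: measurable_tentE.
- by move=> u _; rewrite lee_fin mulr_ge0// ltW.
- by apply/measurable_EFinP; exact: measurable_funM.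
under [X in (_ + X <= _)%E -> _]eq_integral do rewrite EFinM.
rewrite ge0_integralZl//; last 2 first.
- by apply/measurable_EFinP.
- by rewrite lee_fin ltW.
rewrite integral_indic// setIT => le1.
rewrite tent_integral_gt; apply: lt_le_trans le1.
have : ((2 * h)%:E <= \int[m]_u (tent y a u)%:E)%E.
  by move: hG; rewrite tent_integralE lee_pdivlMl// EFinM.
move=> h2; apply: (@lt_le_trans _ _ ((2 * h)%:E + c%:E * m K)%E).
  have Kf : m K \is a fin_num by rewrite ge0_fin_numE.
  by rewrite lteDl// mule_gt0// lte_fin.
by rewrite leeD2r.
Qed.

(** A tent of half-width [c + 1] is at least [c] on [[y - 1, y + 1]]. This supplies a large tent
    when the interior is the whole line and there is no cut to provide one. *)
Lemma tent_integral_unbounded (h : R) y :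
  (0 < m `[(y - 1)%R, (y + 1)%R]%classic)%E ->
  exists2 a : R, 0 < a & (h%:E < tent_integral m y a)%E.
Proof.
set K := `[y - 1, y + 1]%classic => K0.
have mK : measurable (K : set (measurableTypeR R)) by exact: measurable_itv.
have mI (D : set (measurableTypeR R)) : measurable_fun D (\1_K : _ -> R) by exact: measurable_indic.
have mt (c : R) : 0 < c -> (c%:E * m K <= \int[m]_u (tent y (c + 1) u)%:E)%E.
  move=> c0; have -> : (c%:E * m K = \int[m]_u (c * \1_K u)%:E)%E.
    under eq_integral do rewrite EFinM.
    rewrite ge0_integralZl//; last 2 first.
    - by apply/measurable_EFinP.
    - by rewrite lee_fin ltW.
    by rewrite integral_indic// setIT.
  apply: ge0_le_integral => //.
  - by move=> u _; rewrite lee_fin mulr_ge0// ltW.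
  - by apply/measurable_EFinP; exact: measurable_funM.
  - exact: measurable_tentE.
  - move=> u _; rewrite lee_fin indicE.
    case: (boolP (u \in K)) => uK; last by rewrite mulr0 tent_ge0.
    rewrite mulr1; move: uK; rewrite /K inE/= in_itv/= => /andP[uK1 uK2].
    have un : `|u - y| <= 1 by rewrite ler_norml; apply/andP; split; lra.
    by rewrite /tent le_max; apply/orP; right; lra.
have [k k0 kK] : exists2 k : R, 0 < k & (k%:E <= m K)%E.
  move: K0; case: (m K) => [k k0|_|//]; first by exists k.
  by exists 1 => //; rewrite leey.
pose c := (2 * `|h| + 1) / k.
have c0 : 0 < c by rewrite divr_gt0//; have := normr_ge0 h; lra.
exists (c + 1); first lra.
rewrite tent_integral_gt; apply: lt_le_trans (mt _ c0).
apply: (@lt_le_trans _ _ (c%:E * k%:E)%E); last by rewrite lee_pmul2l.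
rewrite -EFinM lte_fin /c divfK ?gt_eqF//; have := ler_norm h; lra.
Qed.

End tents.

(** * Distribution functions and potential of the speed measure on a compact window *)

Section potential.
Context {R : realType} (m : {measure set (measurableTypeR R) -> \bar R}).
Implicit Types a b x y z u : R.

Lemma fin_num_sub (S T : set (measurableTypeR R)) : measurable S ->
  measurable T -> (m T < +oo)%E -> S `<=` T -> m S \is a fin_num.
Proof.
move=> mS mT Too ST; rewrite ge0_fin_numE//; apply: le_lt_trans Too.
by apply: le_measure; rewrite ?inE.
Qed.

Lemma fine_measure_itv_split (i j k : itv_bound R) :
  (i <= j)%O -> (j <= k)%O -> (m [set` Interval i k] < +oo)%E ->
  fine (m [set` Interval i k]) =
  fine (m [set` Interval i j]) + fine (m [set` Interval j k]).
Proof.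
move=> ij jk moo; have E := itv_bndbnd_setU ij jk.
have mI (l : interval R) : measurable ([set` l] : set (measurableTypeR R)).
  exact: measurable_itv.
rewrite -fineD.
- rewrite E measureU// -subset0 => z /=; rewrite !itv_boundlr.
  move=> [/andP[_ zj] /andP[jz _]].
  by have := le_trans zj jz; rewrite bnd_simp ltxx.
- by apply: fin_num_sub moo _ => //; rewrite E; exact: subsetUl.
- by apply: fin_num_sub moo _ => //; rewrite E; exact: subsetUr.
Qed.

Variables (A B : R).
Hypothesis mAB : (m `[A, B]%classic < +oo)%E.

(** Both versions of the distribution function are kept, because the right and the left slope are
    built from half-open intervals of opposite kinds. *)
Definition cdfr x : R := fine (m `[A, x]%classic).
Definition cdfl x : R := fine (m `[A, x[%classic).

Lemma fine_measure_subitv (l : interval R) :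
  [set` l] `<=` `[A, B]%classic -> m [set` l] \is a fin_num.
Proof. by move=> lAB; apply: fin_num_sub mAB lAB => //; exact: measurable_itv. Qed.

Lemma subitv_lty (l : interval R) :
  [set` l] `<=` `[A, B]%classic -> (m [set` l] < +oo)%E.
Proof. by move=> /fine_measure_subitv; rewrite ge0_fin_numE. Qed.

Ltac itvsub := move=> ? /=; rewrite !in_itv/= => /andP[? ?]; apply/andP; split; lra.

Lemma measure_oc x z : A <= x -> x <= z -> z <= B ->
  fine (m `]x, z]%classic) = cdfr z - cdfr x.
Proof.
move=> Ax xz zB; rewrite /cdfr (@fine_measure_itv_split (BLeft A) (BRight x) (BRight z)).
- by rewrite addrAC subrr add0r.
- by rewrite bnd_simp.
- by rewrite bnd_simp.
- by apply: subitv_lty; itvsub.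
Qed.

Lemma measure_co x z : A <= x -> x <= z -> z <= B ->
  fine (m `[x, z[%classic) = cdfl z - cdfl x.
Proof.
move=> Ax xz zB; rewrite /cdfl (@fine_measure_itv_split (BLeft A) (BLeft x) (BLeft z)).
- by rewrite addrAC subrr add0r.
- by rewrite bnd_simp.
- by rewrite bnd_simp.
- by apply: subitv_lty; itvsub.
Qed.

Lemma measure_cc x z : A <= x -> x <= z -> z <= B ->
  fine (m `[x, z]%classic) = cdfr z - cdfl x.
Proof.
move=> Ax xz zB; rewrite /cdfr /cdfl (@fine_measure_itv_split (BLeft A) (BLeft x) (BRight z)).
- by rewrite addrAC subrr add0r.
- by rewrite bnd_simp.
- by rewrite bnd_simp.
- by apply: subitv_lty; itvsub.
Qed.

Lemma measure_oo x z : A <= x -> x < z -> z <= B ->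
  fine (m `]x, z[%classic) = cdfl z - cdfr x.
Proof.
move=> Ax xz zB; rewrite /cdfr /cdfl (@fine_measure_itv_split (BLeft A) (BRight x) (BLeft z)).
- by rewrite addrAC subrr add0r.
- by rewrite bnd_simp.
- by rewrite bnd_simp.
- by apply: subitv_lty; itvsub.
Qed.

Lemma cdfl_le_cdfr x : A <= x -> x <= B -> cdfl x <= cdfr x.
Proof.
move=> Ax xB; rewrite -subr_ge0 -measure_cc// fine_ge0//.
Qed.

Lemma cdfr_le_cdfl x z : A <= x -> x < z -> z <= B -> cdfr x <= cdfl z.
Proof. by move=> Ax xz zB; rewrite -subr_ge0 -measure_oo// fine_ge0. Qed.

Lemma cdfr_le x z : A <= x -> x <= z -> z <= B -> cdfr x <= cdfr z.
Proof. by move=> Ax xz zB; rewrite -subr_ge0 -measure_oc// fine_ge0. Qed.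

Lemma cdfl_le x z : A <= x -> x <= z -> z <= B -> cdfl x <= cdfl z.
Proof. by move=> Ax xz zB; rewrite -subr_ge0 -measure_co// fine_ge0. Qed.

Lemma right_slopeE y a : 0 < a -> A <= y - a -> y + a <= B ->
  right_slope m y a = (2 * cdfr y - cdfr (y + a) - cdfr (y - a)) /
    (cdfr (y + a) - cdfr (y - a)).
Proof.
move=> a0 Aa aB; rewrite /right_slope !measure_oc; lra.
Qed.

Lemma left_slopeE y a : 0 < a -> A <= y - a -> y + a <= B ->
  left_slope m y a = (2 * cdfl y - cdfl (y + a) - cdfl (y - a)) /
    (cdfl (y + a) - cdfl (y - a)).
Proof.
move=> a0 Aa aB; rewrite /left_slope !measure_co; lra.
Qed.

(** Continuity of [m] from above, available because the window has finite mass. It is the source of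
    the one-sided continuity of [cdfr] and [cdfl]. *)
Lemma shrinking_small (F : nat -> interval R) (e : R) : 0 < e ->
  [set` F 0%N] `<=` `[A, B]%classic ->
  (forall n k, (n <= k)%N -> [set` F k] `<=` [set` F n]) ->
  (forall z, exists n, ~ (z \in F n)) ->
  exists n, fine (m [set` F n]) < e.
Proof.
move=> e0 F0 Fd Fe.
pose G n : set (measurableTypeR R) := [set` F n].
have mG n : measurable (G n) by exact: measurable_itv.
have G0 : \bigcap_n G n = set0.
  rewrite -subset0 => z Gz; have [n] := Fe z; apply.
  exact: (Gz n I).
have := @nonincreasing_cvg_mu _ _ _ m G.
rewrite G0 measure0 => /(_ (subitv_lty F0) mG measurable0).
have Gd : nonincreasing_seq G by move=> n k nk; apply/subsetPset; exact: Fd.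
move=> /(_ Gd) /fine_cvgP[_] /cvgrPdist_lt/(_ _ e0) [n _ /(_ n (leqnn n))] /=.
rewrite sub0r normrN => Gn; exists n.
by apply: le_lt_trans Gn; exact: ler_norm.
Qed.

Lemma cdfr_right_lt x (e : R) : A <= x -> x < B -> 0 < e ->
  exists2 d : R, 0 < d & forall z, x <= z -> z <= x + d -> z <= B /\ cdfr z < cdfr x + e.
Proof.
move=> Ax xB e0.
pose d (n : nat) : R := (B - x) * n.+1%:R^-1.
have dB n : d n <= B - x.
  by rewrite /d ler_piMr ?subr_ge0 ?(ltW xB)// invf_le1// ler1n.
have d0 n : 0 < d n by rewrite /d mulr_gt0 ?subr_gt0// invr_gt0.
have dd n k : (n <= k)%N -> d k <= d n.
  move=> nk; rewrite /d ler_wpM2l ?subr_ge0 ?(ltW xB)//.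
  by rewrite lef_pV2 ?posrE// ler_nat ltnS.
have [|n1 n2 n12|z|n nb] := @shrinking_small (fun n => `]x, x + d n]) e e0.
- have := dB 0%N => ?; itvsub.
- by have := dd _ _ n12 => ?; itvsub.
- have [zx|xz] := leP z x; first by exists 0%N; rewrite in_itv/= ltNge zx.
  have /cvgrPdist_lt : d @ \oo --> (B - x) * 0.
    by apply: cvgM; [exact: cvg_cst|exact: cvg_harmonic].
  rewrite mulr0 => /(_ (z - x)); rewrite subr_gt0 => /(_ xz)[n _ /(_ n (leqnn n))]/=.
  rewrite sub0r normrN gtr0_norm// => dn; exists n.
  by rewrite in_itv/= => /andP[_]; lra.
exists (d n); first exact: d0.
move=> z xz zd; have zB : z <= B by have := dB n; lra.
split => //; have := @cdfr_le z (x + d n); have := dB n; have := d0 n.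
move: nb; rewrite measure_oc; [|lra|by have := d0 n; lra|by have := dB n; lra].
move=> ? ? ?; have -> : A <= z by lra. by rewrite zd => /(_ isT isT); lra.
Qed.

Lemma cdfl_left_gt x (e : R) : A < x -> x <= B -> 0 < e ->
  exists2 d : R, 0 < d & forall z, x - d <= z -> z <= x -> A <= z /\ cdfl x - e < cdfl z.
Proof.
move=> Ax xB e0.
pose d (n : nat) : R := (x - A) * n.+1%:R^-1.
have dB n : d n <= x - A.
  by rewrite /d ler_piMr ?subr_ge0 ?(ltW Ax)// invf_le1// ler1n.
have d0 n : 0 < d n by rewrite /d mulr_gt0 ?subr_gt0// invr_gt0.
have dd n k : (n <= k)%N -> d k <= d n.
  move=> nk; rewrite /d ler_wpM2l ?subr_ge0 ?(ltW Ax)//.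
  by rewrite lef_pV2 ?posrE// ler_nat ltnS.
have [|n1 n2 n12|z|n nb] := @shrinking_small (fun n => `[x - d n, x[) e e0.
- have := dB 0%N => ?; itvsub.
- by have := dd _ _ n12 => ?; itvsub.
- have [xz|zx] := leP x z; first by exists 0%N; rewrite in_itv/= ltNge xz andbF.
  have /cvgrPdist_lt : d @ \oo --> (x - A) * 0.
    by apply: cvgM; [exact: cvg_cst|exact: cvg_harmonic].
  rewrite mulr0 => /(_ (x - z)); rewrite subr_gt0 => /(_ zx)[n _ /(_ n (leqnn n))]/=.
  rewrite sub0r normrN gtr0_norm// => dn; exists n.
  by rewrite in_itv/= => /andP[]; lra.
exists (d n); first exact: d0.
move=> z zd zx; have zA : A <= z by have := dB n; lra.
split => //; have := @cdfl_le (x - d n) z; have := dB n; have := d0 n.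
move: nb; rewrite measure_co; [|by have := dB n; lra|by have := d0 n; lra|lra].
move=> ? ? ?; have -> : A <= x - d n by lra. 
have -> : z <= B by lra. by rewrite zd => /(_ isT isT isT); lra.
Qed.

Lemma near_right_inside x : A <= x -> x < B -> \forall z \near x^'+, x < z < B.
Proof.
move=> Ax xB; near=> z; apply/andP; split; near: z.
  exact: nbhs_right_gt.
exact: nbhs_right_lt.
Unshelve. all: by end_near. Qed.

Lemma near_left_inside x : A < x -> x <= B -> \forall z \near x^'-, A < z < x.
Proof.
move=> Ax xB; near=> z; apply/andP; split; near: z.
  exact: nbhs_left_gt.
exact: nbhs_left_lt.
Unshelve. all: by end_near. Qed.

Lemma cdfr_cvg_right x : A <= x -> x < B -> cdfr z @[z --> x^'+] --> cdfr x.
Proof.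
move=> Ax xB; apply/cvgrPdist_lt => e e0.
have [d d0 H] := cdfr_right_lt Ax xB e0.
near=> z.
have xz : x < z by near: z; exact: nbhs_right_gt.
have zd : z <= x + d by near: z; apply: nbhs_right_le; lra.
have [zB ?] := H z (ltW xz) zd.
have := cdfr_le Ax (ltW xz) zB.
by rewrite ltr_norml => ?; apply/andP; split; lra.
Unshelve. all: by end_near. Qed.

Lemma cdfl_cvg_left x : A < x -> x <= B -> cdfl z @[z --> x^'-] --> cdfl x.
Proof.
move=> Ax xB; apply/cvgrPdist_lt => e e0.
have [d d0 H] := cdfl_left_gt Ax xB e0.
near=> z.
have zx : z < x by near: z; exact: nbhs_left_lt.
have zd : x - d <= z by near: z; apply: nbhs_left_ge; lra.
have [zA ?] := H z zd (ltW zx).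
have := cdfl_le zA (ltW zx) xB.
by rewrite ltr_norml => ?; apply/andP; split; lra.
Unshelve. all: by end_near. Qed.

(** For [z > x], [cdfl z] is squeezed between [cdfr x] and [cdfr z]. Approached from one side, both
    versions have the same limit, which is why right and left slopes share their one-sided
    limits. *)
Lemma cdfl_cvg_right x : A <= x -> x < B -> cdfl z @[z --> x^'+] --> cdfr x.
Proof.
move=> Ax xB; apply: (@squeeze_cvgr _ _ _ _ (cst (cdfr x)) cdfr).
- apply: filterS (near_right_inside Ax xB) => z /andP[xz zB].
  by rewrite cdfr_le_cdfl ?cdfl_le_cdfr//=; lra.
- exact: cvg_cst.
- exact: cdfr_cvg_right.
Qed.

Lemma cdfr_cvg_left x : A < x -> x <= B -> cdfr z @[z --> x^'-] --> cdfl x.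
Proof.
move=> Ax xB; apply: (@squeeze_cvgr _ _ _ _ cdfl (cst (cdfl x))).
- apply: filterS (near_left_inside Ax xB) => z /andP[Az zx].
  by rewrite cdfr_le_cdfl ?cdfl_le_cdfr//=; lra.
- exact: cdfl_cvg_left.
- exact: cvg_cst.
Qed.

(* On [A, B] the right derivative of [pot] is [cdfr], its left one is [cdfl]. *)
Definition pot x : R := \int[m]_(u in `[A, B]%classic) Num.max 0 (x - u).

Let mABm : measurable (`[A, B]%classic : set (measurableTypeR R)).
Proof. exact: measurable_itv. Qed.

Lemma bounded_integrable (f : measurableTypeR R -> R) (M : R) :
  measurable_fun `[A, B]%classic f ->
  (forall u, A <= u -> u <= B -> `|f u| <= M) ->
  m.-integrable `[A, B]%classic (EFin \o f).
Proof.
move=> mf fM; apply: measurable_bounded_integrable => //.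
exists M; split; first exact: num_real.
move=> k Mk u /=; rewrite in_itv/= => /andP[Au uB].
by apply: le_trans (fM _ Au uB) (ltW Mk).
Qed.

Lemma pot_integrable x :
  m.-integrable `[A, B]%classic (EFin \o (fun u => Num.max 0 (x - u))).
Proof.
apply: (@bounded_integrable _ (`|x - A| + `|x - B|)).
  apply: (@measurable_maxr _ _ _ _ (cst 0) (fun u => x - u)) => //.
  exact: measurable_funB.
move=> u Au uB; rewrite ger0_norm ?le_max ?lexx// ge_max.
have := ler_norm (x - A); have := normr_ge0 (x - B); have := normr_ge0 (x - A).
move=> ? ? ?; apply/andP; split; lra.
Qed.

Lemma indic_integrable (c : R) (l : interval R) :
  m.-integrable `[A, B]%classic (EFin \o (fun u => c * \1_[set` l] u)).
Proof.
apply: (@bounded_integrable _ `|c|).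
  by apply: measurable_funM => //; apply: measurable_indic; exact: measurable_itv.
move=> u _ _; rewrite normrM indicE; case: (_ \in _); rewrite ?normr1 ?mulr1//.
by rewrite normr0 mulr0.
Qed.

Lemma Rintegral_cindic (c : R) (l : interval R) :
  [set` l] `<=` `[A, B]%classic ->
  \int[m]_(u in `[A, B]%classic) (c * \1_[set` l] u) = c * fine (m [set` l]).
Proof.
move=> lAB; have ml : measurable ([set` l] : set (measurableTypeR R)).
  exact: measurable_itv.
rewrite RintegralZl//.
  by rewrite /Rintegral integral_indic// setIidl.
have := indic_integrable 1 l; congr (integrable _ _ _).
by apply/funext => u/=; rewrite mul1r.
Qed.

Lemma pot_sub x z : pot z - pot x =
  \int[m]_(u in `[A, B]%classic) (Num.max 0 (z - u) - Num.max 0 (x - u)).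
Proof. by rewrite RintegralB//; exact: pot_integrable. Qed.

Lemma potB_integrable x z : m.-integrable `[A, B]%classic
  (EFin \o (fun u => Num.max 0 (z - u) - Num.max 0 (x - u))).
Proof.
exact: (integrableB mABm (pot_integrable z) (pot_integrable x)).
Qed.

(** The integrand of [pot z - pot x] dominates [z - x] times the indicator of [[A, x]]. With
    [pot_slope_le] these are the subgradient inequalities of the convex function [pot], which yield
    its one-sided derivatives. *)
Lemma pot_slope_ge x z : A <= x -> x <= z -> z <= B ->
  (z - x) * cdfr x <= pot z - pot x.
Proof.
move=> Ax xz zB; rewrite pot_sub -Rintegral_cindic; last by itvsub.
apply: le_Rintegral => //.
- exact: indic_integrable.
- exact: potB_integrable.
move=> u _; rewrite indicE mem_setE in_itv/=.
case: (boolP (_ && _)) => [/andP[Au ux]|_].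
  by rewrite mulr1 !max_r; lra.
rewrite mulr0 subr_ge0 ge_max le_max lexx/= le_max; apply/orP; right; lra.
Qed.

Lemma pot_slope_le x z : A <= x -> x <= z -> z <= B ->
  pot z - pot x <= (z - x) * cdfl z.
Proof.
move=> Ax xz zB; rewrite pot_sub -Rintegral_cindic; last by itvsub.
apply: le_Rintegral => //.
- exact: potB_integrable.
- exact: indic_integrable.
move=> u/=; rewrite in_itv/= => /andP[Au uB].
rewrite indicE mem_setE in_itv/= Au/=.
have [uz|zu] := ltP u z.
  rewrite mulr1 [Num.max 0 (z - u)]max_r; last lra.
  have : x - u <= Num.max 0 (x - u) by rewrite le_max lexx orbT.
  lra.
by rewrite mulr0 !max_l; lra.
Qed.

(** Pointwise, a tent is the second difference of the hinges [x |-> max 0 (x - u)] at [y - a], [y],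
    [y + a], and it vanishes off the window. *)
Lemma tent_integral_pot y a : 0 <= a -> A <= y - a -> y + a <= B ->
  tent_integral m y a = ((pot (y + a) + pot (y - a) - 2 * pot y) / 2)%:E.
Proof.
move=> a0 Aa aB; rewrite tent_integralE.
have mt (D : set (measurableTypeR R)) : measurable_fun D (tent y a).
  exact: measurable_tent.
have -> : (\int[m]_u (tent y a u)%:E =
    \int[m]_(u in `[A, B]%classic) (tent y a u)%:E)%E.
  rewrite [RHS]integral_mkcond; apply: eq_integral => u _; rewrite patchE.
  case: ifPn => //; rewrite mem_setE in_itv/= => /negP uAB.
  rewrite /tent max_l// leNgt; apply/negP => h; apply: uAB.
  have : `|u - y| < a by lra.
  rewrite ltr_norml => /andP[? ?]; apply/andP; split; lra.
have it : m.-integrable `[A, B]%classic (EFin \o (tent y a)).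
  apply: (@bounded_integrable _ a); first exact: mt.
  move=> u _ _.
  rewrite ger0_norm ?tent_ge0// /tent ge_max a0/=.
  by have := normr_ge0 (u - y); lra.
have -> : (\int[m]_(u in `[A, B]%classic) (tent y a u)%:E =
    (\int[m]_(u in `[A, B]%classic) (tent y a u))%:E)%E.
  by rewrite /Rintegral fineK//; exact: integrable_fin_num.
rewrite -EFinM mulrC; congr (_ / _)%:E.
have -> : pot (y + a) + pot (y - a) - 2 * pot y =
  (pot (y + a) - pot y) - (pot y - pot (y - a)) by ring.
rewrite !pot_sub -RintegralB//; try exact: potB_integrable.
apply: eq_Rintegral => u _; rewrite /tent.
have [yu|uy] := leP y u.
  rewrite ger0_norm ?subr_ge0//.
  rewrite [Num.max 0 (y - u)]max_l; last lra.
  rewrite [Num.max 0 (y - a - u)]max_l; last lra.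
  have -> : a - (u - y) = y + a - u by ring.
  by ring.
rewrite ltr0_norm ?subr_lt0//.
rewrite [Num.max 0 (y - u)]max_r; last lra.
rewrite [Num.max 0 (y + a - u)]max_r; last lra.
have [au|ua] := leP (y - a) u.
  rewrite [Num.max 0 (y - a - u)]max_l; last lra.
  by rewrite max_r; lra.
rewrite [Num.max 0 (y - a - u)]max_r; last lra.
by rewrite max_l; lra.
Qed.

End potential.
(* [lra] fails in the presence of hypotheses on extended reals. *)
Ltac rlra := repeat match goal with
  | H : is_true (@Order.lt ereal_display _ _ _) |- _ => clear H
  | H : is_true (@Order.le ereal_display _ _ _) |- _ => clear H
  end; lra.

(** * The scale factor as the root of the implicit equation *)

Section scale_factor_root.
Context {R : realType} (m : {measure set (measurableTypeR R) -> \bar R}).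
Implicit Types (l r : \bar R) (I O : set R) (h y a b : R).

Lemma tent_integral0 y : tent_integral m y 0 = 0%E.
Proof.
rewrite tent_integralE (eq_integral (cst 0%E)) ?integral0 ?mule0// => u _.
by rewrite /tent max_l// sub0r oppr_le0.
Qed.

Lemma speed_like_lty O a b : speed_like m O -> O a -> O b ->
  (m `[a, b]%classic < +oo)%E.
Proof.
move=> [oO _ hm] Oa Ob; have [ab|ba] := leP a b; last first.
  by rewrite set_itv_ge ?measure0// bnd_simp -ltNge.
have [e e0 eO] := open_window oO Ob.
have Obe : O (b + e) by apply: eO; rewrite addrAC subrr add0r gtr0_norm.
have [|_ abe] := hm a (b + e) Oa Obe; first lra.
apply: le_lt_trans abe; apply: le_measure; rewrite ?inE//.
by move=> u /=; rewrite !in_itv/= => /andP[? ?]; apply/andP; split; lra.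
Qed.

Lemma speed_like_conv O a b y : speed_like m O -> O a -> O b ->
  a <= y -> y <= b -> O y.
Proof. by move=> [_ cO _] Oa Ob ay yb; apply: (cO a b) => //; rewrite ay. Qed.

(** The last hypothesis places [y] at or below the midpoint of [l0] and [r]. This rules out the
    convention for the empty infimum, which puts the cut at the midpoint (at [+oo] if [r = +oo]). *)
Lemma lower_cut_lt (l0 : R) r h y : (l0%:E < r)%E ->
  (lower_cut l0%:E r m h < y%:E)%E ->
  ((y + (y - l0))%:E <= r)%E ->
  exists a, [/\ 0 < a, a < y - l0 & (h%:E <= tent_integral m (l0 + a) a)%E].
Proof.
move=> lr; rewrite /lower_cut /inf_or; case: asboolP => [_|]; last first.
  move=> _; rewrite addeC -lteBrDr// -EFinB => /ereal_inf_lt[_ [a [a0 _ ha] <-]].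
  by rewrite lte_fin => ay _; exists a.
case: r lr => [r| |]//; last by rewrite addye// gt0_mulye ?lte_fin// addey.
by move=> _; rewrite -EFinB -EFinM -EFinD lte_fin lee_fin; lra.
Qed.

Lemma upper_cut_gt (r0 : R) l h y : (l < r0%:E)%E ->
  (y%:E < upper_cut l r0%:E m h)%E ->
  (l <= (y - (r0 - y))%:E)%E ->
  exists a, [/\ 0 < a, a < r0 - y & (h%:E <= tent_integral m (r0 - a) a)%E].
Proof.
move=> lr; rewrite /upper_cut /inf_or; case: asboolP => [_|]; last first.
  move=> _; set X := ereal_inf _ => yX.
  have : (X < (r0 - y)%:E)%E.
    case: X yX => [x| |]//=; last by rewrite ltNyr.
    by rewrite -EFinB !lte_fin; lra.
  move=> /ereal_inf_lt[_ [a [a0 _ ha] <-]].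
  by rewrite lte_fin => ay _; exists a.
case: l lr => [l| |]//; last by rewrite /= addey// gt0_mulye ?lte_fin//.
by move=> _; rewrite -(EFinB r0 l) -EFinM -EFinB lte_fin lee_fin; lra.
Qed.

Lemma lt_tent_integral_inside O h y b : 0 < b -> (h%:E < tent_integral m y b)%E ->
  (forall a, 0 < a -> a < b -> O (y - a) /\ O (y + a)) ->
  exists a, [/\ 0 < a, O (y - a), O (y + a) & (h%:E < tent_integral m y a)%E].
Proof.
move=> b0 hb Oab; have [a [a0 ab ha]] := tent_integral_lsc b0 hb.
(* [a] may be 0; the maximum with [b / 2] makes the half-width positive and keeps it below [b]. *)
pose c := Num.max a (b / 2).
have c0 : 0 < c by rewrite lt_max; apply/orP; right; lra.
have cb : c < b by rewrite gt_max ab/=; lra.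
have ac : a <= c by rewrite le_max lexx.
have [? ?] := Oab c c0 cb.
exists c; split => //; apply: lt_le_trans ha _; apply: le_tent_integral.
by rewrite subrr normr0 subr_ge0.
Qed.

Lemma cut_interval_sub l r h y : (l < r)%E ->
  cut_interval l r m h y -> ointv l r y.
Proof.
move=> lr [ly yr]; split.
  clear yr; case: l lr ly => [l| |] lr ly; [|by move: lr; rewrite ltNge leey|by rewrite ltNyr].
  rewrite lte_fin ltNge; apply/negP => yl.
  (* A point [y <= l] would give [0 < a < y - l <= 0]. *)
  have [|a [a0 al _]] := lower_cut_lt lr ly; last by clear lr ly; lra.
  by apply: le_trans (ltW lr); rewrite lee_fin; clear lr ly; lra.
clear ly; case: r lr yr => [r| |] lr yr; [|by rewrite ltry|by move: lr; rewrite ltNge leNye].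
rewrite lte_fin ltNge; apply/negP => ry.
have [|a [a0 ar _]] := upper_cut_gt lr yr; last by clear lr yr; lra.
by apply: le_trans (ltW lr) _; rewrite lee_fin; clear lr yr; lra.
Qed.

(** The cut at the nearer end point provides a tent with a foot there and integral at least [h]. The
    tent centred at [y] with a foot at the same end point is wider by exactly the distance of the
    centres, so its integral exceeds [h]; shrinking it slightly brings both feet into the
    interior. *)
Lemma cut_interval_exceeds l r h y : (l < r)%E -> 0 < h ->
  speed_like m (ointv l r) -> cut_interval l r m h y ->
  exists a, [/\ 0 < a, ointv l r (y - a), ointv l r (y + a) &
    (h%:E < tent_integral m y a)%E].
Proof.
move=> lr h0 sl Jy; have Oy := cut_interval_sub lr Jy; case: Jy => ly yr.
have lower (l0 : R) : l = l0%:E -> ((y + (y - l0))%:E <= r)%E ->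
  exists a, [/\ 0 < a, ointv l r (y - a), ointv l r (y + a) &
    (h%:E < tent_integral m y a)%E].
  move=> ll0 yl0r; move: ly; rewrite ll0 => ly; rewrite ll0 in lr.
  have [a [a0 ayl ha]] := lower_cut_lt lr ly yl0r.
  apply: (@lt_tent_integral_inside _ _ _ (y - l0)).
  - rlra.
  - rewrite -ll0 in lr; apply: (tent_integral_strict sl Oy) ha => //; first exact: ltW.
    by rewrite (_ : l0 + a - y = - (y - l0 - a)); [rewrite normrN ger0_norm; rlra|ring].
  - move=> c c0 cyl; rewrite /ointv/= !lte_fin; split; split; [rlra| |rlra|];
      by apply: lt_le_trans yl0r; rewrite lte_fin; rlra.
have upper (r0 : R) : r = r0%:E -> (l <= (y - (r0 - y))%:E)%E ->
  exists a, [/\ 0 < a, ointv l r (y - a), ointv l r (y + a) &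
    (h%:E < tent_integral m y a)%E].
  move=> rr0 yr0l; move: yr; rewrite rr0 => yr; rewrite rr0 in lr.
  have [a [a0 ayr ha]] := upper_cut_gt lr yr yr0l.
  apply: (@lt_tent_integral_inside _ _ _ (r0 - y)).
  - rlra.
  - rewrite -rr0 in lr; apply: (tent_integral_strict sl Oy) ha => //; first exact: ltW.
    by rewrite (_ : r0 - a - y = r0 - y - a); [rewrite ger0_norm; rlra|ring].
  - move=> c c0 cyr; rewrite /ointv/= !lte_fin; split; split; [|rlra| |rlra];
      by apply: le_lt_trans yr0l _; rewrite lte_fin; rlra.
move: lr sl ly yr Oy lower upper.
case: l => [l0| |]; case: r => [r0| |] lr sl ly yr Oy lower upper.
- have [h1|h1] := leP (y + (y - l0)) r0.
    by apply: (lower l0) => //; rewrite lee_fin.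
  by apply: (upper r0) => //; rewrite lee_fin; rlra.
- by apply: (lower l0) => //; rewrite leey.
- by move: lr; rewrite ltNge leNye.
- by move: lr; rewrite ltNge leey.
- by move: lr; rewrite ltNge leey.
- by move: lr; rewrite ltNge leey.
- by apply: (upper r0) => //; rewrite leNye.
- have Oall z : ointv (-oo%E : \bar R) +oo%E z by split; rewrite ?ltNyr ?ltry.
  have [_ _ hm] := sl.
  have [|a a0 ha] := @tent_integral_unbounded _ m h y.
    by have [|] := hm (y - 1) (y + 1) (Oall _) (Oall _); first rlra.
  by exists a.
- by move: lr; rewrite ltxx.
Qed.

Definition root_of O h y a := [/\ 0 < a, O (y - a), O (y + a) &
  tent_integral m y a = h%:E].

Lemma speed_like_center O y a : speed_like m O -> 0 <= a -> O (y - a) ->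
  O (y + a) -> O y.
Proof. by move=> sl a0 O1 O2; apply: (speed_like_conv sl O1 O2); lra. Qed.

(** Otherwise the integral of the wider tent would be strictly larger, although both equal [h].
    Equal centres give uniqueness of the root, distinct ones the Lipschitz bound. *)
Lemma root_of_strict O h y a y' a' : speed_like m O -> root_of O h y a ->
  root_of O h y' a' -> a < a' -> a' - a < `|y - y'|.
Proof.
move=> sl [a0 O1 O2 G1] [a'0 O1' O2' G2] aa'; rewrite ltNge; apply/negP => yy.
have Oy' := speed_like_center sl (ltW a'0) O1' O2'.
have := tent_integral_strict sl Oy' (ltW a0) aa' yy.
by rewrite G1 G2 => /(_ h (lexx _)); rewrite ltxx.
Qed.

Lemma root_of_unique O h y a a' : speed_like m O -> root_of O h y a ->
  root_of O h y a' -> a = a'.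
Proof.
move=> sl r1 r2; apply/eqP; rewrite eq_le !leNgt; apply/andP; split; apply/negP.
  by move=> aa'; have := root_of_strict sl r2 r1 aa'; rewrite subrr normr0; lra.
by move=> aa'; have := root_of_strict sl r1 r2 aa'; rewrite subrr normr0; lra.
Qed.

Lemma root_of_lipschitz O h y a y' a' : speed_like m O -> root_of O h y a ->
  root_of O h y' a' -> y < y' -> `|a' - a| < y' - y.
Proof.
move=> sl r1 r2 yy'; have [aa'|aa'|->] := ltgtP a a'; last first.
- by rewrite subrr normr0; lra.
- have := root_of_strict sl r2 r1 aa'; rewrite gtr0_norm; last lra.
  by rewrite ltr0_norm; lra.
- have := root_of_strict sl r1 r2 aa'; rewrite ltr0_norm; last lra.
  by rewrite gtr0_norm; lra.
Qed.

(** The tent of half-width [a1] caps the supremum inside the interior. Lower semicontinuity gives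
    one inequality at the supremum, Lipschitz continuity of the potential the other. *)
Lemma scale_factor_root I h y a1 : speed_like m (interior I) -> 0 < h -> 0 < a1 ->
  interior I (y - a1) -> interior I (y + a1) -> (h%:E < tent_integral m y a1)%E ->
  root_of (interior I) h y (scale_factor I m h y).
Proof.
move=> sl h0 a10 O1 O2 ha1.
have Oy : interior I y by apply: speed_like_center O1 O2 => //; exact: ltW.
rewrite /scale_factor asboolT//.
set S := [set a | _]; set s := sup S.
have OI z : y - a1 <= z -> z <= y + a1 -> interior I z.
  by move=> ? ?; exact: (speed_like_conv sl O1 O2).
have S0 : S 0.
  split; rewrite ?subr0 ?addr0 ?tent_integral0 ?lee_fin ?(ltW h0)//;
    exact: interior_subset.
have Sa1 a : S a -> a < a1.
  move=> [a0 _ _ ha]; rewrite ltNge; apply/negP => a1a.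
  have := lt_le_trans ha1 (@le_tent_integral _ m y a1 y a _).
  by rewrite subrr normr0 subr_ge0 => /(_ a1a); rewrite ltNge ha.
have ubS : has_ubound S by exists a1 => a /Sa1/ltW.
have hS : has_sup S by split => //; exists 0.
have s0 : 0 <= s by exact: ub_le_sup.
have sa1 : s <= a1 by apply: ge_sup => [|a /Sa1/ltW//]; exists 0.
have Gsh : (tent_integral m y s <= h%:E)%E.
  rewrite leNgt; apply/negP => hs.
  have s_gt0 : 0 < s.
    rewrite lt_neqAle s0 andbT; apply/eqP => s_eq0.
    by move: hs; rewrite -s_eq0 tent_integral0 lte_fin ltNge ltW.
  have [a [a0 as_ ha]] := tent_integral_lsc s_gt0 hs.
  have sa : 0 < s - a by lra.
  have [a' Sa'] := sup_adherent sa hS; rewrite -/s => aa'.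
  have := lt_le_trans ha (@le_tent_integral _ m y a y a' _).
  rewrite subrr normr0 subr_ge0; case: Sa' => _ _ _ Sa'.
  have -> : a <= a' by lra.
  by move=> /(_ isT); rewrite ltNge Sa'.
have mAB := speed_like_lty sl O1 O2.
have potE a : 0 <= a -> a <= a1 -> tent_integral m y a = _ :=
  fun p q => tent_integral_pot mAB p (lerB (lexx y) q) (lerD (lexx y) q).
have hGs : (h%:E <= tent_integral m y s)%E.
  rewrite leNgt; apply/negP => hs.
  have s_lt_a1 : s < a1.
    rewrite lt_neqAle sa1 andbT; apply/eqP => sE.
    by move: hs; rewrite sE ltNge (ltW ha1).
  set A := y - a1 in mAB potE *; set B := y + a1 in mAB potE *.
  pose M := cdfl m A B.
  have M0 : 0 <= M by exact: fine_ge0.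
  move: hs; rewrite potE// lte_fin.
  set p := pot m A B; move=> hs.
  pose gap := h - (p (y + s) + p (y - s) - 2 * p y) / 2.
  have gap0 : 0 < gap by rewrite /gap; lra.
  (* [M] bounds the slopes of the potential on the window, so widening by [d] raises the tent
     integral by at most [d * M / 2], which is below the gap; [M + 1] avoids a zero denominator. *)
  pose d := Num.min (a1 - s) (gap / (M + 1)).
  have M1 : 0 < M + 1 by lra.
  have d0 : 0 < d by rewrite lt_min divr_gt0// andbT; lra.
  have d1 : d <= a1 - s by rewrite ge_min lexx.
  have d2 : d * (M + 1) <= gap by rewrite -ler_pdivlMr// ge_min lexx orbT.
  suff : S (s + d) by move=> /(ub_le_sup ubS); rewrite -/s; lra.
  split; [lra|apply: interior_subset; apply: OI; lra|
    apply: interior_subset; apply: OI; lra|].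
  rewrite potE; [|lra|lra]; rewrite -/p lee_fin.
  have := @pot_slope_le _ m A B mAB (y + s) (y + (s + d)).
  have := @pot_slope_ge _ m A B mAB (y - (s + d)) (y - s).
  have : cdfl m A (y + (s + d)) <= M by apply: (cdfl_le mAB); rewrite /A /B; lra.
  set t := cdfl m A (y + (s + d)) => tM.
  have : 0 <= cdfr m A (y - (s + d)) by exact: fine_ge0.
  set t' := cdfr _ _ _ => t'0; rewrite -/p.
  have -> : y - s - (y - (s + d)) = d by ring.
  have -> : y + (s + d) - (y + s) = d by ring.
  have A1 : A <= y - (s + d) by rewrite /A; lra.
  have B1 : y + (s + d) <= B by rewrite /B; lra.
  have dt : d * t <= d * (M + 1) by rewrite ler_pM2l//; lra.
  have dt' : 0 <= d * t' by rewrite mulr_ge0// ltW.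
  move=> H1 H2.
  have {}H1 : d * t' <= p (y - s) - p (y - (s + d)) by apply: H1; rewrite /B; lra.
  have {}H2 : p (y + (s + d)) - p (y + s) <= d * t by apply: H2; rewrite /A; lra.
  by rewrite /gap in d2; lra.
have GsE : tent_integral m y s = h%:E by apply/eqP; rewrite eq_le Gsh hGs.
have s_gt0 : 0 < s.
  rewrite lt_neqAle s0 andbT; apply/eqP => s_eq0.
  by move: GsE; rewrite -s_eq0 tent_integral0 => -[]; lra.
by split => //; apply: OI; lra.
Qed.

End scale_factor_root.
(** * One-sided derivatives *)

Section one_sided_calculus.
Context {R : realType}.
Implicit Types (Phi f : R -> R) (x y z P Q S e d t : R).

(** Free of division and including [t = 0], so that it applies to increments [t + D] and [t - D]
    that may vanish. *)
Definition right_diff Phi x S := forall e : R, 0 < e -> exists2 d, 0 < d &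
  forall t, 0 <= t -> t <= d -> `|Phi (x + t) - Phi x - S * t| <= e * t.

Definition second_diff Phi f z := Phi (z + f z) + Phi (z - f z) - 2 * Phi z.

(** The Lipschitz bound makes the increments [t + D] of [z + f z] and [t - D] of [z - f z]
    nonnegative and at most [2 * t]; hence the halved radii [d1 / 2] and [d2 / 2]. *)
Lemma second_diff_expansion Phi f y P Q S :
  right_diff Phi (y + f y) P -> right_diff Phi (y - f y) Q ->
  right_diff Phi y S ->
  (exists2 d : R, 0 < d & forall t, 0 <= t -> t <= d -> `|f (y + t) - f y| <= t) ->
  forall e : R, 0 < e -> exists2 d : R, 0 < d & forall t, 0 <= t -> t <= d ->
    `|second_diff Phi f (y + t) - second_diff Phi f y -
      ((P - Q) * (f (y + t) - f y) + (P + Q - 2 * S) * t)| <= e * t.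
Proof.
move=> DP DQ DS [d0 d00 lip] e e0.
have e4 : 0 < e / 4 by lra.
have [d1 d10 H1] := DP _ e4.
have [d2 d20 H2] := DQ _ e4.
have [d3 d30 H3] := DS _ e4.
exists (Num.min (Num.min d0 d3) (Num.min (d1 / 2) (d2 / 2))).
  by rewrite !lt_min d00 d30 !divr_gt0.
move=> t t0; rewrite !le_min => /andP[/andP[td0 td3] /andP[td1 td2]].
have := lip t t0 td0; rewrite ler_norml => /andP[l1 l2].
set D := f (y + t) - f y in l1 l2 *.
have := H3 t t0 td3.
have := H1 (t + D); have -> : y + f y + (t + D) = y + t + f (y + t).
  by rewrite /D; ring.
have := H2 (t - D); have -> : y - f y + (t - D) = y + t - f (y + t).
  by rewrite /D; ring.
move=> {}H2 {}H1; have {}H2 := H2 _ _; have {}H1 := H1 _ _.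
move: H1; have -> : 0 <= t + D by lra.
have -> : t + D <= d1 by lra.
move: H2; have -> : 0 <= t - D by lra.
have -> : t - D <= d2 by lra.
move=> /(_ isT isT) H2 /(_ isT isT) H1 {}H3.
rewrite /second_diff.
set p := Phi (y + f y) in H1 *; set p' := Phi (y + t + f (y + t)) in H1 *.
set q := Phi (y - f y) in H2 *; set q' := Phi (y + t - f (y + t)) in H2 *.
set s := Phi y in H3 *; set s' := Phi (y + t) in H3 *.
have -> : p' + q' - 2 * s' - (p + q - 2 * s) - ((P - Q) * D + (P + Q - 2 * S) * t)
  = (p' - p - P * (t + D)) + (q' - q - Q * (t - D)) - 2 * (s' - s - S * t) by ring.
have -> : e * t = e / 4 * (t + D) + e / 4 * (t - D) + 2 * (e / 4 * t) by field.
apply: le_trans (ler_normB _ _) _; apply: lerD.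
  by apply: le_trans (ler_normD _ _) _; apply: lerD.
by rewrite normrM ger0_norm// ler_wpM2l.
Qed.

(** On a level curve the expansion reads [(P - Q) * D + (P + Q - 2 * S) * t = o(t)], and [Q < P]
    allows solving for [D / t]. *)
Lemma right_quotient_level Phi f y P Q S :
  right_diff Phi (y + f y) P -> right_diff Phi (y - f y) Q ->
  right_diff Phi y S -> Q < P ->
  (exists2 d : R, 0 < d & forall t, 0 <= t -> t <= d -> `|f (y + t) - f y| <= t /\
     second_diff Phi f (y + t) = second_diff Phi f y) ->
  right_quotient f y t @[t --> 0^'+] --> (2 * S - P - Q) / (P - Q).
Proof.
move=> DP DQ DS QP [d0 d00 H0].
have PQ0 : 0 < P - Q by lra.
apply/cvgrPdist_le => /= e e0.
have ePQ : 0 < e * (P - Q) by rewrite mulr_gt0.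
have [|d d1 H] := second_diff_expansion DP DQ DS _ ePQ.
  by exists d0 => // t t0 td; have [] := H0 t t0 td.
near=> t.
have t0 : 0 < t by near: t; exact: nbhs_right_gt.
have td : t <= d by near: t; exact: nbhs_right_le.
have td0 : t <= d0 by near: t; exact: nbhs_right_le.
have := H t (ltW t0) td; have [_ ->] := H0 t (ltW t0) td0.
rewrite subrr sub0r normrN /right_quotient.
set D := f (y + t) - f y => HD.
have -> : (2 * S - P - Q) / (P - Q) - D / t =
  - (((P - Q) * D + (P + Q - 2 * S) * t) / ((P - Q) * t)).
  by field; rewrite !gt_eqF//= .
have Pt : 0 < (P - Q) * t by rewrite mulr_gt0.
by rewrite normrN normrM normfV (gtr0_norm Pt) ler_pdivrMr// mulrA.
Unshelve. all: by end_near. Qed.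

Lemma derivable_right_quotient f y : derivable f y 1 ->
  right_quotient f y t @[t --> 0^'+] --> derive1 f y.
Proof.
move=> df; rewrite derive1E.
have : (fun t : R => t^-1 *: ((f \o shift y) (t *: (1 : R)) - f y)) @ 0^' -->
  'D_1 f y by exact: df.
move=> /cvg_dnbhs_at_right; apply: cvg_trans; apply: near_eq_cvg.
near=> t; rewrite /right_quotient /=.
by rewrite [_ *: (1 : R)]mulr1 (addrC t) [_ *: _]mulrC.
Unshelve. all: by end_near. Qed.

Lemma cvg_right_left_dnbhs (g : R -> R) (x L : R) :
  g t @[t --> x^'+] --> L -> g t @[t --> x^'-] --> L -> g t @[t --> x^'] --> L.
Proof.
move=> /cvgrPdist_le gr /cvgrPdist_le gl; apply/cvgrPdist_le => e e0.
have := gr e e0; have := gl e e0.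
rewrite !near_withinE => nl nr; apply: filterS2 nl nr => t hl hr.
by rewrite neq_lt => /orP[/hl|/hr].
Qed.

Lemma derivable_of_quotients f y (L : R) :
  right_quotient f y t @[t --> 0^'+] --> L ->
  left_quotient f y t @[t --> 0^'+] --> L ->
  derivable f y 1 /\ derive1 f y = L.
Proof.
move=> rq lq.
suff cf : (fun t : R => t^-1 *: ((f \o shift y) (t *: (1 : R)) - f y)) @ 0^' --> L.
  split; first by apply/cvg_ex; exists L.
  by rewrite derive1E; exact/cvg_lim.
apply: cvg_right_left_dnbhs.
  apply: cvg_trans rq; apply: near_eq_cvg.
  near=> t; rewrite /right_quotient /=.
  by rewrite [_ *: (1 : R)]mulr1 (addrC t) [_ *: _]mulrC.
apply/cvg_at_leftNP; rewrite oppr0.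
apply: cvg_trans lq; apply: near_eq_cvg.
near=> t; rewrite /left_quotient /=.
by rewrite [_ *: (1 : R)]mulr1 (addrC (- t)) [_ *: _]mulrC invrN mulrN -mulNr opprB.
Unshelve. all: by end_near. Qed.

(** The expansion read backwards: the prescribed derivative of [f] cancels its linear part. *)
Lemma second_diff_ode Phi f y P Q S :
  right_diff Phi (y + f y) P -> right_diff Phi (y - f y) Q ->
  right_diff Phi y S -> Q < P ->
  (exists2 d : R, 0 < d & forall t, 0 <= t -> t <= d -> `|f (y + t) - f y| <= t) ->
  derivable f y 1 -> derive1 f y = (2 * S - P - Q) / (P - Q) ->
  forall e : R, 0 < e -> \forall t \near 0^'+,
    `|second_diff Phi f (y + t) - second_diff Phi f y| <= e * t.
Proof.
move=> DP DQ DS QP lip df f' e e0.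
have PQ0 : 0 < P - Q by lra.
have e2 : 0 < e / 2 by lra.
have eP : 0 < e / 2 / (P - Q) by rewrite divr_gt0.
have [d d0 H] := second_diff_expansion DP DQ DS lip e2.
have := derivable_right_quotient df; rewrite f'.
move=> /cvgrPdist_le/(_ _ eP) Hq.
near=> t.
have t0 : 0 < t by near: t; exact: nbhs_right_gt.
have td : t <= d by near: t; exact: nbhs_right_le.
have := H t (ltW t0) td.
set X := second_diff _ _ _ - _; set Z := (_ * _ + _) => HX.
have HZ : `|Z| <= e / 2 * t.
  have : `|(2 * S - P - Q) / (P - Q) - right_quotient f y t| <= e / 2 / (P - Q).
    by near: t.
  rewrite /right_quotient.
  have -> : (2 * S - P - Q) / (P - Q) - (f (y + t) - f y) / t =
    - (Z / ((P - Q) * t)).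
    by rewrite /Z; field; rewrite !gt_eqF.
  have Pt : 0 < (P - Q) * t by rewrite mulr_gt0.
  rewrite normrN normrM normfV (gtr0_norm Pt) ler_pdivrMr//.
  by rewrite mulrA divfK// gt_eqF.
have -> : X = (X - Z) + Z by ring.
apply: le_trans (ler_normD _ _) _; lra.
Unshelve. all: by end_near. Qed.

End one_sided_calculus.

(** * One-sided derivatives of a curve of roots and the limits of its slopes *)

Section level_curve.
Context {R : realType} (m : {measure set (measurableTypeR R) -> \bar R}).
Implicit Types (O J : set R) (h y z a b x p q A B : R) (f : R -> R).

(** The quotient over [[x, x + t]] lies between [cdfr x] and [cdfl (x + t)], and right continuity
    keeps the latter below [cdfr x + e]. *)
Lemma right_diff_pot A B x : (m `[A, B]%classic < +oo)%E -> A <= x -> x < B ->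
  right_diff (pot m A B) x (cdfr m A x).
Proof.
move=> mAB Ax xB e e0; have [d d0 H] := cdfr_right_lt mAB Ax xB e0.
exists d => // t t0 td.
have [||xtB ct] := H (x + t); try lra.
have := @pot_slope_ge _ m A B mAB x (x + t) Ax _ xtB.
have := @pot_slope_le _ m A B mAB x (x + t) Ax _ xtB.
have := @cdfl_le_cdfr _ m A B mAB (x + t) _ xtB.
set L := cdfl _ _ _ => HL.
have -> : x + t - x = t by ring.
have -> : x <= x + t by lra.
move=> /(_ isT) H1 /(_ isT) H2.
have Axt : A <= x + t by lra.
have {}HL : L <= cdfr m A x + e by have := HL Axt; lra.
have := ler_wpM2l t0 HL; rewrite mulrDr => H3.
by rewrite ler_norml; apply/andP; split; lra.
Qed.

Lemma left_diff_pot A B x : (m `[A, B]%classic < +oo)%E -> A < x -> x <= B ->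
  right_diff (fun z => pot m A B (- z)) (- x) (- cdfl m A x).
Proof.
move=> mAB Ax xB e e0; have [d d0 H] := cdfl_left_gt mAB Ax xB e0.
exists d => // t t0 td; rewrite opprD opprK.
have [||Axt ct] := H (x - t); try lra.
have := @pot_slope_ge _ m A B mAB (x - t) x Axt _ xB.
have := @pot_slope_le _ m A B mAB (x - t) x Axt _ xB.
have := @cdfl_le_cdfr _ m A B mAB (x - t) Axt _.
set L := cdfr _ _ _ => HL.
have -> : x - (x - t) = t by ring.
have -> : x - t <= x by lra.
move=> /(_ isT) H1 /(_ isT) H2.
have xtB : x - t <= B by lra.
have {}HL : cdfl m A x - e <= L by have := HL xtB; lra.
have := ler_wpM2l t0 HL; rewrite mulrBr => H3.
by rewrite ler_norml; apply/andP; split; lra.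
Qed.

Lemma cdf_strict O A B p q : speed_like m O -> (m `[A, B]%classic < +oo)%E ->
  O q -> O p -> A <= q -> q < p -> p <= B -> cdfr m A q < cdfl m A p.
Proof.
move=> sl mAB Oq Op Aq qp pB; rewrite -subr_gt0 -(measure_oo mAB)//.
have Oi z : q <= z -> z <= p -> O z by move=> ? ?; exact: (speed_like_conv sl Oq Op).
(* Positivity of [m] is given on compact intervals; the middle third is one inside []q, p[]. *)
set q' : R := q + (p - q) / 3; set p' : R := p - (p - q) / 3.
have [m0 _] : ((0 < m `[q', p']%classic) /\ (m `[q', p']%classic < +oo))%E.
  by have [_ _ hm] := sl; apply: hm; [apply: Oi|apply: Oi|]; rewrite /q' /p'; lra.
apply: fine_gt0; apply/andP; split.
  apply: (lt_le_trans m0); apply: le_measure; rewrite ?inE//.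
  by move=> u /=; rewrite !in_itv/= /q' /p' => /andP[? ?]; apply/andP; split; lra.
apply: (subitv_lty mAB).
by move=> u /=; rewrite !in_itv/= => /andP[? ?]; apply/andP; split; lra.
Qed.

(** Moving the centre and the half-width by at most [d] each shifts a foot by at most [2 * d]; the
    margin [3 * d] keeps it strictly inside the window. *)
Lemma speed_like_window O y a : speed_like m O -> O (y - a) -> O (y + a) ->
  exists A B d : R, [/\ O A, O B, 0 < d, A + 3 * d = y - a & y + a + 3 * d = B].
Proof.
move=> [oO _ _] O1 O2.
have [e1 e10 H1] := open_window oO O1; have [e2 e20 H2] := open_window oO O2.
pose e := Num.min e1 e2.
have e0 : 0 < e by rewrite lt_min e10 e20.
exists (y - a - e), (y + a + e), (e / 3); split; try lra.
- apply: H1; rewrite addrAC subrr sub0r normrN gtr0_norm//.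
  by rewrite ge_min lexx.
- apply: H2; rewrite addrAC subrr add0r gtr0_norm//.
  by rewrite ge_min lexx orbT.
Qed.

Variables (O J : set R) (h : R) (f : R -> R).
Hypothesis sl : speed_like m O.
Hypothesis oJ : open J.
Hypothesis Jroot : forall y, J y -> root_of m O h y (f y).

Lemma level_lipschitz y z : J y -> J z -> `|f z - f y| <= `|z - y|.
Proof.
move=> Jy Jz; have [yz|zy|->] := ltgtP y z; last by rewrite !subrr.
  have := root_of_lipschitz sl (Jroot Jy) (Jroot Jz) yz.
  by move=> /ltW; rewrite (@gtr0_norm _ (z - y))// subr_gt0.
have := root_of_lipschitz sl (Jroot Jz) (Jroot Jy) zy.
by move=> /ltW; rewrite distrC (@ltr0_norm _ (z - y))// ?subr_lt0// opprB.
Qed.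

Lemma level_add_lt y z : J y -> J z -> y < z -> y + f y < z + f z.
Proof.
move=> Jy Jz yz; have := root_of_lipschitz sl (Jroot Jy) (Jroot Jz) yz.
by rewrite ltr_norml => /andP[? ?]; lra.
Qed.

Lemma level_sub_lt y z : J y -> J z -> y < z -> y - f y < z - f z.
Proof.
move=> Jy Jz yz; have := root_of_lipschitz sl (Jroot Jy) (Jroot Jz) yz.
by rewrite ltr_norml => /andP[? ?]; lra.
Qed.

(** One window serves all tents near [y], which turns the root property into constancy of a second
    difference of a single [pot]. *)
Lemma level_window y : J y -> exists A B d : R,
  [/\ O A, O B, 0 < d, (m `[A, B]%classic < +oo)%E & forall z, `|z - y| <= d ->
    [/\ J z, 0 < f z, A < z - f z, z + f z < B &
       second_diff (pot m A B) f z = 2 * h] ].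
Proof.
move=> Jy; have [f0 O1 O2 _] := Jroot Jy.
have [A [B [d1 [OA OB d10 AE BE]]]] := speed_like_window sl O1 O2.
have [d2 d20 HJ] := open_window oJ Jy.
have mAB := speed_like_lty sl OA OB.
exists A, B, (Num.min d1 d2); split => //; first by rewrite lt_min d10 d20.
move=> z; rewrite le_min => /andP[zd1 zd2].
have Jz := HJ z zd2.
have := le_trans (level_lipschitz Jy Jz) zd1; move: zd1.
rewrite !ler_norml => /andP[? ?] /andP[? ?].
have [fz0 _ _ Gz] := Jroot Jz.
have Az : A < z - f z by lra.
have zB : z + f z < B by lra.
split => //; move: Gz.
rewrite (tent_integral_pot mAB (ltW fz0) (ltW Az) (ltW zB)) => -[].
by rewrite /second_diff; lra.
Qed.

Lemma level_right_quotient y : J y ->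
  right_quotient f y t @[t --> 0^'+] --> right_slope m y (f y).
Proof.
move=> Jy; have [A [B [d [OA OB d0 mAB W]]]] := level_window Jy.
have [|_ fy0 Ay yB Gy] := W y; first by rewrite subrr normr0 ltW.
have [_ O1 O2 _] := Jroot Jy.
rewrite (right_slopeE mAB)//; try exact: ltW.
have qp : cdfr m A (y - f y) < cdfr m A (y + f y).
  apply: (@lt_le_trans _ _ (cdfl m A (y + f y))).
    by apply: (cdf_strict sl mAB) => //; lra.
  by apply: (cdfl_le_cdfr mAB); lra.
apply: (@right_quotient_level _ (pot m A B)) => //.
- by apply: right_diff_pot => //; lra.
- by apply: right_diff_pot => //; lra.
- by apply: right_diff_pot => //; lra.
- exists d => // t t0 td.
  have [|Jt _ _ _ Gt] := W (y + t).
    by rewrite addrAC subrr add0r ger0_norm.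
  rewrite Gt Gy; split => //.
  by have := level_lipschitz Jy Jt; rewrite addrAC subrr add0r (ger0_norm t0).
Qed.

(* Reduces to the right quotient by the reflection [z |-> - z], which turns the
   right derivative [cdfr] of [pot] into [- cdfl]. *)
Lemma level_left_quotient y : J y ->
  left_quotient f y t @[t --> 0^'+] --> left_slope m y (f y).
Proof.
move=> Jy; have [A [B [d [OA OB d0 mAB W]]]] := level_window Jy.
have [|_ fy0 Ay yB Gy] := W y; first by rewrite subrr normr0 ltW.
have [_ O1 O2 _] := Jroot Jy.
rewrite (left_slopeE mAB)//; try exact: ltW.
have qp : cdfl m A (y - f y) < cdfl m A (y + f y).
  apply: (@le_lt_trans _ _ (cdfr m A (y - f y))).
    by apply: (cdfl_le_cdfr mAB); lra.
  by apply: (cdf_strict sl mAB) => //; lra.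
have sdE z : second_diff (fun z => pot m A B (- z)) (fun z => f (- z)) z =
    second_diff (pot m A B) f (- z).
  rewrite /second_diff !opprD opprK; ring.
have lqE : left_quotient f y = \- right_quotient (fun z => f (- z)) (- y).
  apply/funext => t; rewrite /left_quotient /right_quotient/= opprD !opprK.
  by rewrite -mulNr opprB.
have -> : (2 * cdfl m A y - cdfl m A (y + f y) - cdfl m A (y - f y)) /
    (cdfl m A (y + f y) - cdfl m A (y - f y)) =
  - ((2 * - cdfl m A y - - cdfl m A (y - f y) - - cdfl m A (y + f y)) /
     (- cdfl m A (y - f y) - - cdfl m A (y + f y))).
  by rewrite -mulNr; congr (_ / _); ring.
rewrite lqE; apply: cvgN.
apply: (@right_quotient_level _ (fun z => pot m A B (- z)) (fun z => f (- z))).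
- have -> : - y + f (- - y) = - (y - f y) by rewrite opprK opprB addrC.
  by apply: left_diff_pot => //; lra.
- have -> : - y - f (- - y) = - (y + f y) by rewrite opprK opprD.
  by apply: left_diff_pot => //; lra.
- by apply: left_diff_pot => //; lra.
- by rewrite ltrN2.
- exists d => // t t0 td; rewrite (sdE (- y + t)) (sdE (- y)).
  rewrite opprD !opprK.
  have [|Jt _ _ _ Gt] := W (y - t).
    by rewrite addrAC subrr add0r normrN ger0_norm.
  rewrite Gt Gy; split => //.
  have := level_lipschitz Jy Jt.
  by rewrite addrAC subrr add0r normrN (ger0_norm t0).
Qed.

Lemma cvg_to_right (T : Type) (F : set_system T) {FF : Filter F} (u : T -> R) x :
  (\forall t \near F, x < u t) -> u t @[t --> F] --> x -> u t @[t --> F] --> x^'+.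
Proof.
move=> xu ux Q; rewrite /at_right /= => QN.
by apply: filterS2 xu (ux _ QN) => t ? /=; apply.
Qed.

Lemma cvg_to_left (T : Type) (F : set_system T) {FF : Filter F} (u : T -> R) x :
  (\forall t \near F, u t < x) -> u t @[t --> F] --> x -> u t @[t --> F] --> x^'-.
Proof.
move=> xu ux Q; rewrite /at_left /= => QN.
by apply: filterS2 xu (ux _ QN) => t ? /=; apply.
Qed.

Lemma slope_cvg (T : Type) (F : set_system T) {FF : Filter F} (s p q : T -> R)
    (S P Q : R) : s t @[t --> F] --> S -> p t @[t --> F] --> P ->
  q t @[t --> F] --> Q -> Q < P ->
  (2 * s t - p t - q t) / (p t - q t) @[t --> F] --> (2 * S - P - Q) / (P - Q).
Proof.
move=> sS pP qQ QP; apply: cvgM.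
  by apply: cvgB => //; apply: cvgB => //; apply: cvgM => //; exact: cvg_cst.
by apply: cvgV; [rewrite gt_eqF// subr_gt0|exact: cvgB].
Qed.

Lemma level_cvg (F : set_system R) {FF : Filter F} y : J y ->
  F --> nbhs y -> f z @[z --> F] --> f y.
Proof.
move=> Jy Fy; apply/cvgrPdist_le => e e0.
have [A [B [d [_ _ d0 _ W]]]] := level_window Jy.
have de : 0 < Num.min d e by rewrite lt_min d0.
have near_y : \forall z \near F, `|y - z| <= Num.min d e.
  by have /cvgrPdist_le/(_ _ de) := Fy; apply.
apply: filterS near_y => z; rewrite le_min distrC => /andP[zd ze].
have [Jz _ _ _ _] := W _ zd.
by rewrite distrC; apply: le_trans (level_lipschitz Jy Jz) _.
Qed.

(** As [z] decreases to [y], the points [z + f z] and [z - f z] approach their limits strictly from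
    the right, where [cdfr] and [cdfl] both tend to [cdfr]. So both slopes tend to the right
    slope. *)
Lemma level_slope_cvg_right y : J y ->
  right_slope m z (f z) @[z --> y^'+] --> right_slope m y (f y) /\
  left_slope m z (f z) @[z --> y^'+] --> right_slope m y (f y).
Proof.
move=> Jy; have [A [B [d [OA OB d0 mAB W]]]] := level_window Jy.
have [|_ fy0 Ay yB Gy] := W y; first by rewrite subrr normr0 ltW.
have [_ O1 O2 _] := Jroot Jy.
rewrite (right_slopeE mAB)//; try exact: ltW.
have qp : cdfr m A (y - f y) < cdfr m A (y + f y).
  apply: (@lt_le_trans _ _ (cdfl m A (y + f y))).
    by apply: (cdf_strict sl mAB) => //; lra.
  by apply: (cdfl_le_cdfr mAB); lra.
have near_y : \forall z \near y^'+, y < z /\ `|z - y| <= d.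
  near=> z; have yz : y < z by near: z; exact: nbhs_right_gt.
  split => //; rewrite gtr0_norm ?subr_gt0//.
  by apply: ltW; near: z; exact: nbhs_right_ltDr.
have idy : z @[z --> y^'+] --> y by exact: cvg_within.
have fy : f z @[z --> y^'+] --> f y by apply: level_cvg => //; exact: cvg_within.
have idr : z @[z --> y^'+] --> y^'+ by exact: cvg_id.
have pr : z + f z @[z --> y^'+] --> (y + f y)^'+.
  apply: cvg_to_right; last exact: cvgD.
  apply: filterS near_y => z [yz zd]; have [Jz _ _ _ _] := W z zd.
  exact: level_add_lt.
have qr : z - f z @[z --> y^'+] --> (y - f y)^'+.
  apply: cvg_to_right; last exact: cvgB.
  apply: filterS near_y => z [yz zd]; have [Jz _ _ _ _] := W z zd.
  exact: level_sub_lt.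
have := (@cdfr_cvg_right _ m A B mAB, @cdfl_cvg_right _ m A B mAB) => -[HR HL].
split.
- apply: (@cvg_trans _ ((2 * cdfr m A z - cdfr m A (z + f z) - cdfr m A (z - f z)) /
    (cdfr m A (z + f z) - cdfr m A (z - f z)) @[z --> y^'+])).
    apply: near_eq_cvg; apply: filterS near_y => z [yz zd].
    have [Jz fz0 Az zB _] := W z zd.
    by rewrite (right_slopeE mAB)// ltW.
  apply: slope_cvg => //.
  + by apply: HR; lra.
  + by apply: (cvg_comp _ _ pr); apply: HR; lra.
  + by apply: (cvg_comp _ _ qr); apply: HR; lra.
- apply: (@cvg_trans _ ((2 * cdfl m A z - cdfl m A (z + f z) - cdfl m A (z - f z)) /
    (cdfl m A (z + f z) - cdfl m A (z - f z)) @[z --> y^'+])).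
    apply: near_eq_cvg; apply: filterS near_y => z [yz zd].
    have [Jz fz0 Az zB _] := W z zd.
    by rewrite (left_slopeE mAB)// ltW.
  apply: slope_cvg => //.
  + by apply: HL; lra.
  + by apply: (cvg_comp _ _ pr); apply: HL; lra.
  + by apply: (cvg_comp _ _ qr); apply: HL; lra.
Unshelve. all: by end_near. Qed.

Lemma level_slope_cvg_left y : J y ->
  right_slope m z (f z) @[z --> y^'-] --> left_slope m y (f y) /\
  left_slope m z (f z) @[z --> y^'-] --> left_slope m y (f y).
Proof.
move=> Jy; have [A [B [d [OA OB d0 mAB W]]]] := level_window Jy.
have [|_ fy0 Ay yB Gy] := W y; first by rewrite subrr normr0 ltW.
have [_ O1 O2 _] := Jroot Jy.
rewrite (left_slopeE mAB)//; try exact: ltW.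
have qp : cdfl m A (y - f y) < cdfl m A (y + f y).
  apply: (@le_lt_trans _ _ (cdfr m A (y - f y))).
    by apply: (cdfl_le_cdfr mAB); lra.
  by apply: (cdf_strict sl mAB) => //; lra.
have near_y : \forall z \near y^'-, z < y /\ `|z - y| <= d.
  near=> z; have yz : z < y by near: z; exact: nbhs_left_lt.
  split => //; rewrite distrC gtr0_norm ?subr_gt0//.
  by apply: ltW; near: z; exact: nbhs_left_ltBl.
have idy : z @[z --> y^'-] --> y by exact: cvg_within.
have fy : f z @[z --> y^'-] --> f y by apply: level_cvg => //; exact: cvg_within.
have idr : z @[z --> y^'-] --> y^'- by exact: cvg_id.
have pr : z + f z @[z --> y^'-] --> (y + f y)^'-.
  apply: cvg_to_left; last exact: cvgD.
  apply: filterS near_y => z [yz zd]; have [Jz _ _ _ _] := W z zd.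
  exact: level_add_lt.
have qr : z - f z @[z --> y^'-] --> (y - f y)^'-.
  apply: cvg_to_left; last exact: cvgB.
  apply: filterS near_y => z [yz zd]; have [Jz _ _ _ _] := W z zd.
  exact: level_sub_lt.
have := (@cdfr_cvg_left _ m A B mAB, @cdfl_cvg_left _ m A B mAB) => -[HR HL].
split.
- apply: (@cvg_trans _ ((2 * cdfr m A z - cdfr m A (z + f z) - cdfr m A (z - f z)) /
    (cdfr m A (z + f z) - cdfr m A (z - f z)) @[z --> y^'-])).
    apply: near_eq_cvg; apply: filterS near_y => z [yz zd].
    have [Jz fz0 Az zB _] := W z zd.
    by rewrite (right_slopeE mAB)// ltW.
  apply: slope_cvg => //.
  + by apply: HR; lra.
  + by apply: (cvg_comp _ _ pr); apply: HR; lra.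
  + by apply: (cvg_comp _ _ qr); apply: HR; lra.
- apply: (@cvg_trans _ ((2 * cdfl m A z - cdfl m A (z + f z) - cdfl m A (z - f z)) /
    (cdfl m A (z + f z) - cdfl m A (z - f z)) @[z --> y^'-])).
    apply: near_eq_cvg; apply: filterS near_y => z [yz zd].
    have [Jz fz0 Az zB _] := W z zd.
    by rewrite (left_slopeE mAB)// ltW.
  apply: slope_cvg => //.
  + by apply: HL; lra.
  + by apply: (cvg_comp _ _ pr); apply: HL; lra.
  + by apply: (cvg_comp _ _ qr); apply: HL; lra.
Unshelve. all: by end_near. Qed.

End level_curve.

(** * Countability of the exceptional points and regularity of the derivatives *)

Section level_regularity.
Context {R : realType} (m : {measure set (measurableTypeR R) -> \bar R}).
Implicit Types (O J : set R) (h y z a b x p q A B : R) (f : R -> R).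

Definition atoms O : set R := [set x | O x /\ m [set x] != 0%E].

Lemma measure_set1 A B x : (m `[A, B]%classic < +oo)%E -> A <= x -> x <= B ->
  cdfr m A x = cdfl m A x + fine (m [set x]).
Proof.
by move=> mAB Ax xB; have := measure_cc mAB Ax (lexx x) xB; rewrite set_itv1 => ->; ring.
Qed.

(* Distinct atoms give disjoint open jump intervals of the distribution
   function. *)
Lemma countable_atoms_window A B : (m `[A, B]%classic < +oo)%E ->
  countable [set x | [/\ A < x, x < B & m [set x] != 0%E]].
Proof.
move=> mAB; set D := [set x | _].
(* The default []0, 1[] keeps [U x] open and nonempty for every index, as [separated_open_countable]
   demands; disjointness is asked only on [D]. *)
pose U (x : R) : set R := if cdfl m A x < cdfr m A x
  then `]cdfl m A x, cdfr m A x[%classic else `]0, 1[%classic.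
have DU x : D x -> cdfl m A x < cdfr m A x.
  move=> [Ax xB mx]; rewrite (measure_set1 mAB (ltW Ax) (ltW xB)) ltrDl.
  rewrite fine_gt0// lt0e mx measure_ge0/=.
  rewrite -set_itv1; apply: (subitv_lty mAB).
  by move=> u /=; rewrite !in_itv/= => /andP[? ?]; apply/andP; split; rlra.
have DI x z : D x -> D z -> x < z -> U x `&` U z = set0.
  move=> Dx Dz xz; rewrite /U !DU// -subset0 => u []; rewrite /= !in_itv/=.
  case: Dx => Ax xB _; case: Dz => Az zB _.
  have := cdfr_le_cdfl mAB (ltW Ax) xz (ltW zB).
  by move=> ? /andP[? ?] /andP[? ?]; rlra.
apply: (@separated_open_countable _ _ U).
- by move=> x; rewrite /U; case: ifP => _; exact: itv_open.
- move=> x; rewrite /U; case: ifPn => [lx|_]; [pose u := (cdfl m A x + cdfr m A x) / 2|pose u : R := 1 / 2].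
    by exists u; rewrite /= in_itv/= /u; apply/andP; split; rlra.
  by exists u; rewrite /= in_itv/= /u; apply/andP; split; rlra.
- apply/trivIsetP => x z Dx Dz; rewrite neq_lt => /orP[xz|zx]; first exact: DI.
  by rewrite setIC; exact: DI.
Qed.

(** Mass is finite window by window, and countably many windows with rational end points in [O]
    cover [O]. *)
Lemma countable_atoms O : speed_like m O -> countable (atoms O).
Proof.
move=> sl.
pose K (pq : rat * rat) : set R := [set x | [/\ ratr pq.1 < x, x < ratr pq.2,
  O (ratr pq.1), O (ratr pq.2) & m [set x] != 0%E]].
apply: (@sub_countable _ _ _ (\bigcup_(pq in [set: rat * rat]) K pq)).
  apply: subset_card_le => x [Ox mx].
  have [oO _ _] := sl; have [e e0 eO] := open_window oO Ox.
  have [|p] := @rat_in_itvoo _ (x - e) x; first rlra.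
  rewrite in_itv/= => /andP[p1 p2].
  have [|q] := @rat_in_itvoo _ x (x + e); first rlra.
  rewrite in_itv/= => /andP[q1 q2].
  exists (p, q) => //; split => //=.
    by apply: eO; rewrite ler_norml; apply/andP; split; rlra.
  by apply: eO; rewrite ler_norml; apply/andP; split; rlra.
apply: bigcup_countable; first exact: countableP.
move=> [p q] _; have [[Op Oq]|nO] := pselect (O (ratr p) /\ O (ratr q)).
  apply: sub_countable (countable_atoms_window (speed_like_lty sl Op Oq)).
  by apply: subset_card_le => x [].
apply: (@sub_countable _ _ _ set0); last exact: countable0.
by apply: subset_card_le => x [_ _ Op Oq _]; apply: nO.
Qed.

Lemma countableU (D E : set R) : countable D -> countable E ->
  countable (D `|` E).
Proof.
move=> cD cE.
have -> : D `|` E = \bigcup_(b in [set: bool]) (if b then D else E).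
  apply/seteqP; split => [x [Dx|Ex]|x [[] _ ?]]; [by exists true|by exists false|by left|by right].
by apply: bigcup_countable => [|[]].
Qed.

Lemma countable_inj_preimage J (D : set R) (u : R -> R) : countable D ->
  (forall y z, J y -> J z -> y < z -> u y < u z) ->
  countable [set y | J y /\ D (u y)].
Proof.
move=> /countable_injP[g ginj] umono; apply/countable_injP; exists (g \o u).
move=> y z; rewrite !inE => -[Jy Dy] [Jz Dz] /= gyz.
have uyz : u y = u z by apply: ginj => //; rewrite inE.
have [yz|zy|//] := ltgtP y z.
  by have := umono y z Jy Jz yz; rewrite uyz ltxx.
by have := umono z y Jz Jy zy; rewrite uyz ltxx.
Qed.

Variables (O J : set R) (h : R) (f : R -> R).
Hypothesis sl : speed_like m O.
Hypothesis oJ : open J.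
Hypothesis Jroot : forall y, J y -> root_of m O h y (f y).

Lemma level_right_derivative y : J y ->
  right_derivative f y = right_slope m y (f y).
Proof. by move=> Jy; apply: cvg_lim => //; exact: (level_right_quotient sl oJ Jroot). Qed.

Lemma level_left_derivative y : J y ->
  left_derivative f y = left_slope m y (f y).
Proof. by move=> Jy; apply: cvg_lim => //; exact: (level_left_quotient sl oJ Jroot). Qed.

Lemma near_open_right y : J y -> \forall z \near y^'+, J z.
Proof.
by move=> Jy; apply: cvg_within; exact: open_nbhs_nbhs.
Qed.

Lemma near_open_left y : J y -> \forall z \near y^'-, J z.
Proof.
by move=> Jy; apply: cvg_within; exact: open_nbhs_nbhs.
Qed.

Lemma level_cadlag : cadlag_on J (right_derivative f).
Proof.
move=> y Jy; have [H1 _] := level_slope_cvg_right sl oJ Jroot Jy.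
have [H2 _] := level_slope_cvg_left sl oJ Jroot Jy; split.
  rewrite level_right_derivative//; apply: cvg_trans H1; apply: near_eq_cvg.
  by apply: filterS (near_open_right Jy) => z Jz; rewrite level_right_derivative.
apply/cvg_ex; exists (left_slope m y (f y)); apply: cvg_trans H2.
apply: near_eq_cvg.
by apply: filterS (near_open_left Jy) => z Jz; rewrite level_right_derivative.
Qed.

Lemma level_caglad : caglad_on J (left_derivative f).
Proof.
move=> y Jy; have [_ H1] := level_slope_cvg_right sl oJ Jroot Jy.
have [_ H2] := level_slope_cvg_left sl oJ Jroot Jy; split.
  rewrite level_left_derivative//; apply: cvg_trans H2; apply: near_eq_cvg.
  by apply: filterS (near_open_left Jy) => z Jz; rewrite level_left_derivative.
apply/cvg_ex; exists (right_slope m y (f y)); apply: cvg_trans H1.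
apply: near_eq_cvg.
by apply: filterS (near_open_right Jy) => z Jz; rewrite level_left_derivative.
Qed.

Lemma level_right_derivative_left_limit y : J y ->
  right_derivative f (y - e) @[e --> 0^'+] --> left_derivative f y.
Proof.
move=> Jy; have [H2 _] := level_slope_cvg_left sl oJ Jroot Jy.
have yr : y - e @[e --> (0 : R)^'+] --> y^'-.
  apply: cvg_to_left.
    by near=> e; rewrite gtrBl; near: e; exact: nbhs_right_gt.
  have : y - e @[e --> (0 : R)^'+] --> y - 0.
    by apply: cvgB; [exact: cvg_cst|exact: cvg_within].
  by rewrite subr0.
apply: (@cvg_comp _ _ _ (fun e => y - e) (right_derivative f) _ _ _ yr).
rewrite level_left_derivative//; apply: cvg_trans H2; apply: near_eq_cvg.
by apply: filterS (near_open_left Jy) => z Jz; rewrite level_right_derivative.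
Unshelve. all: by end_near. Qed.

Lemma level_slopes_eq y : J y -> m [set y] = 0%E -> m [set y + f y] = 0%E ->
  m [set y - f y] = 0%E -> right_slope m y (f y) = left_slope m y (f y).
Proof.
move=> Jy my mp mq; have [A [B [d [OA OB d0 mAB W]]]] := level_window sl oJ Jroot Jy.
have [|_ fy0 Ay yB _] := W y; first by rewrite subrr normr0 ltW.
rewrite (right_slopeE mAB)//; try exact: ltW.
rewrite (left_slopeE mAB)//; try exact: ltW.
rewrite (measure_set1 (x := y) mAB); try rlra.
rewrite (measure_set1 (x := y + f y) mAB); try rlra.
rewrite (measure_set1 (x := y - f y) mAB); try rlra.
by rewrite my mp mq /= !addr0.
Qed.

Lemma level_derivable : exists N : set R, [/\ countable N, N `<=` J
  & forall y, J y -> ~ N y ->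
    [/\ derivable f y 1, derive1 f y = right_derivative f y
      & derive1 f y = left_derivative f y] ].
Proof.
(* Off this set the two one-sided quotients have a common limit by construction. It is countable
   because the strictly increasing maps [y + f y] and [y - f y] pull the atoms back to countable
   sets. *)
exists [set y | J y /\ right_slope m y (f y) <> left_slope m y (f y)]; split.
- pose Np := [set y | J y /\ atoms O (y + f y)].
  pose Nq := [set y | J y /\ atoms O (y - f y)].
  have cA := countable_atoms sl.
  have cp : countable Np.
    by apply: countable_inj_preimage => // y z; exact: (level_add_lt sl Jroot).
  have cq : countable Nq.
    by apply: countable_inj_preimage => // y z; exact: (level_sub_lt sl Jroot).
  apply: (@sub_countable _ _ _ (atoms O `|` (Np `|` Nq))).
    apply: subset_card_le => y [Jy ne].
    have [fy0 O1 O2 _] := Jroot Jy.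
    have Oy := speed_like_center sl (ltW fy0) O1 O2.
    apply: contrapT => nA; apply: ne; apply: level_slopes_eq => //.
    + by apply: contrapT => /eqP my; apply: nA; left.
    + by apply: contrapT => /eqP my; apply: nA; right; left.
    + by apply: contrapT => /eqP my; apply: nA; right; right.
  by do 2! apply: countableU => //.
- by move=> y [].
- move=> y Jy nN.
  have E : right_slope m y (f y) = left_slope m y (f y).
    by apply: contrapT => ne; apply: nN.
  rewrite level_right_derivative// level_left_derivative//.
  have := level_left_quotient sl oJ Jroot Jy; rewrite -E => lq.
  have [dy ->] := derivable_of_quotients (level_right_quotient sl oJ Jroot Jy) lq.
  by rewrite E.
Qed.

End level_regularity.

(** * Open intervals with extended end points *)

Section ointv_topology.
Context {R : realType}.
Implicit Types l r : \bar R.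

Lemma ointv_is_interval l r : is_interval (ointv l r).
Proof.
move=> a b [la _] [_ br] y /andP[ay yb]; split.
  by apply: lt_le_trans la _; rewrite lee_fin.
by apply: le_lt_trans br; rewrite lee_fin.
Qed.

Lemma ointv_open l r : open (ointv l r).
Proof.
have -> : ointv l r = [set y | (l < y%:E)%E] `&` [set y | (y%:E < r)%E] by [].
apply: openI.
  case: l => [l| |].
  - rewrite (_ : mkset _ = [set y : R | l < y]); first exact: open_gt.
    by apply/seteqP; split => y /=; rewrite lte_fin.
  - rewrite (_ : mkset _ = set0); first exact: open0.
    by rewrite -subset0 => y /=; rewrite ltNge leey.
  - rewrite (_ : mkset _ = setT); first exact: openT.
    by apply/seteqP; split => y //= _; rewrite ltNyr.
case: r => [r| |].
- rewrite (_ : mkset _ = [set y : R | y < r]); first exact: open_lt.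
  by apply/seteqP; split => y /=; rewrite lte_fin.
- rewrite (_ : mkset _ = setT); first exact: openT.
  by apply/seteqP; split => y //= _; rewrite ltry.
- rewrite (_ : mkset _ = set0); first exact: open0.
  by rewrite -subset0 => y /=; rewrite ltNge leNye.
Qed.

End ointv_topology.

Lemma absolutely_continuous_comp {R : realType} (c d K : R) (a g : R -> R) :
  0 <= K -> absolutely_continuous c d a ->
  (forall u v, c <= u -> u <= v -> v <= d ->
     `|g v - g u| <= K * (`|v - u| + `|a v - a u|)) ->
  absolutely_continuous c d g.
Proof.
move=> K0 aac ga e e0.
(* Then [K * (e' + e') < (K + 1) * (e' + e') = e]; using [K + 1] keeps the inequality strict and
   allows [K = 0]. *)
pose e' := e / (2 * (K + 1)).
have K1 : 0 < 2 * (K + 1) by lra.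
have e'0 : 0 < e' by rewrite divr_gt0.
have [del del0 H] := aac e' e'0.
exists (Num.min del e'); first by rewrite lt_min del0.
move=> n s t st tI; rewrite lt_min => /andP[sd se].
have Ha := H n s t st tI sd.
apply: (@le_lt_trans _ _ (K * (\sum_(i < n) (t i - s i) +
    \sum_(i < n) `|a (t i) - a (s i)|))).
  rewrite -big_split/= mulr_sumr; apply: ler_sum => i _.
  have [ci sti id_] := st i.
  by have := ga _ _ ci sti id_; rewrite (@ger0_norm _ (t i - s i)) ?subr_ge0.
have eE : e = (K + 1) * (e' + e') by rewrite /e'; field; rewrite gt_eqF//; lra.
apply: (@le_lt_trans _ _ (K * (e' + e'))).
  by apply: ler_wpM2l => //; lra.
by rewrite eE ltr_pM2r; lra.
Qed.

Lemma ae_lebesgueS {R : realType} (P Q : set R) : P `<=` Q ->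
  {ae (@lebesgue_measure R), forall x, P x} ->
  {ae (@lebesgue_measure R), forall x, Q x}.
Proof.
by move=> PQ [N [mN N0 PN]]; exists N; split => // x nQ; apply: PN => /PQ.
Qed.

(** * Uniqueness for the ordinary differential equation *)

Section ode_uniqueness.
Context {R : realType} (m : {measure set (measurableTypeR R) -> \bar R}).
Variables (l r : \bar R) (I : set R) (h : R).
Let O := interior I.
Let J := cut_interval l r m h.
Hypothesis sl : speed_like m O.

(** From [Q <= S <= P], the numerator [2 * S - P - Q] lies between [- (P - Q)] and [P - Q]. *)
Lemma right_slope_bound y b : 0 < b -> O (y - b) -> O (y + b) ->
  `|right_slope m y b| <= 1.
Proof.
move=> b0 O1 O2; have [A [B [d [OA OB d0 AE BE]]]] := speed_like_window sl O1 O2.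
have mAB := speed_like_lty sl OA OB.
rewrite (right_slopeE mAB b0); try lra.
have qp : cdfr m A (y - b) < cdfr m A (y + b).
  apply: (@lt_le_trans _ _ (cdfl m A (y + b))).
    by apply: (cdf_strict sl mAB) => //; lra.
  by apply: (cdfl_le_cdfr mAB); lra.
have qs : cdfr m A (y - b) <= cdfr m A y by apply: (cdfr_le mAB); lra.
have sp : cdfr m A y <= cdfr m A (y + b) by apply: (cdfr_le mAB); lra.
set P := cdfr m A (y + b) in qp sp *; set Q := cdfr m A (y - b) in qp qs *.
set S := cdfr m A y in qs sp *.
have PQ : 0 < P - Q by lra.
rewrite normrM normfV (gtr0_norm PQ) ler_pdivrMr// mul1r ler_norml.
by apply/andP; split; lra.
Qed.

Variable a : R -> R.
Hypothesis a_gt0 : forall y, J y -> 0 < a y.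
Hypothesis a_ac : forall c d : R, c <= d -> `[c, d]%classic `<=` J ->
  absolutely_continuous c d a.
Hypothesis a_ode : {ae (@lebesgue_measure R), forall y, J y ->
  derivable a y 1 /\ derive1 a y = ode_field l r I m h y (a y)}.

Lemma ode_field_bound y : `|ode_field l r I m h y (a y)| <= 1.
Proof.
rewrite /ode_field; case: asboolP => [[/= _ b0 O1 O2]|_]; last by rewrite normr0.
exact: right_slope_bound.
Qed.

Lemma cut_segment c d : J c -> J d -> `[c, d]%classic `<=` J.
Proof.
move=> Jc Jd y /=; rewrite in_itv/= => cyd.
exact: (@ointv_is_interval _ _ _ c d).
Qed.

Lemma ode_quotient_near y e : J y -> derivable a y 1 ->
  derive1 a y = ode_field l r I m h y (a y) -> 0 < e ->
  \forall t \near 0^'+, 0 < t /\ - ((1 + e) * t) <= a (y + t) - a y <= (1 + e) * t.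
Proof.
move=> Jy dy da e0.
have := derivable_right_quotient dy => /cvgrPdist_le/(_ _ e0) H.
near=> t; have t0 : 0 < t by near: t; exact: nbhs_right_gt.
split => //; rewrite -ler_norml.
have : `|derive1 a y - right_quotient a y t| <= e by near: t.
have := ode_field_bound y; rewrite -da => F1 Fq.
have : `|right_quotient a y t| <= 1 + e.
  by have := ler_distD 0 (right_quotient a y t) (derive1 a y);
    rewrite subr0 sub0r normrN; move: F1 Fq; rewrite !ler_norml => /andP[? ?] /andP[? ?] _;
    apply/andP; split; lra.
by rewrite /right_quotient normrM normfV (gtr0_norm t0) ler_pdivrMr.
Unshelve. all: by end_near. Qed.

(** Almost everywhere the derivative is [1 + F >= 0]; this includes the points off the good pairs,
    where [F = 0]. *)
Lemma ode_add_nondecreasing c d : J c -> J d -> c <= d -> c + a c <= d + a d.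
Proof.
move=> Jc Jd cd; have cdJ := cut_segment Jc Jd.
apply: (@ac_dini_nondecreasing R c d (fun y => y + a y)) => //.
  apply: (absolutely_continuous_comp (K := 1) _ (a_ac cd cdJ)) => // u v _ _ _.
  rewrite mul1r (_ : _ - _ = (v - u) + (a v - a u)); last by ring.
  exact: ler_normD.
apply: ae_lebesgueS a_ode => x H /andP[cx xd] e e0.
have Jx : J x by apply: cdJ; rewrite /= in_itv/= cx ltW.
have [dx da] := H Jx.
apply: filterS (ode_quotient_near Jx dx da e0) => t [t0 /andP[H1 H2]].
by rewrite (_ : _ - _ = t + (a (x + t) - a x)); [move: H1; rewrite mulrDl mul1r; lra|ring].
Qed.

Lemma ode_sub_nondecreasing c d : J c -> J d -> c <= d -> c - a c <= d - a d.
Proof.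
move=> Jc Jd cd; have cdJ := cut_segment Jc Jd.
apply: (@ac_dini_nondecreasing R c d (fun y => y - a y)) => //.
  apply: (absolutely_continuous_comp (K := 1) _ (a_ac cd cdJ)) => // u v _ _ _.
  rewrite mul1r (_ : _ - _ = (v - u) - (a v - a u)); last by ring.
  exact: ler_normB.
apply: ae_lebesgueS a_ode => x H /andP[cx xd] e e0.
have Jx : J x by apply: cdJ; rewrite /= in_itv/= cx ltW.
have [dx da] := H Jx.
apply: filterS (ode_quotient_near Jx dx da e0) => t [t0 /andP[H1 H2]].
by rewrite (_ : _ - _ = t - (a (x + t) - a x)); [move: H2; rewrite mulrDl mul1r; lra|ring].
Qed.

Lemma ode_lipschitz y z : J y -> J z -> `|a z - a y| <= `|z - y|.
Proof.
move=> Jy Jz; have [yz|zy] := leP y z.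
  rewrite (@ger0_norm _ (z - y)) ?subr_ge0// ler_norml.
  have := ode_add_nondecreasing Jy Jz yz; have := ode_sub_nondecreasing Jy Jz yz.
  by move=> ? ?; apply/andP; split; lra.
rewrite (@ltr0_norm _ (z - y)) ?subr_lt0// ler_norml.
have := ode_add_nondecreasing Jz Jy (ltW zy).
have := ode_sub_nondecreasing Jz Jy (ltW zy).
by move=> ? ?; apply/andP; split; lra.
Qed.

Lemma pot_lipschitz A B u v : (m `[A, B]%classic < +oo)%E -> A <= u -> u <= B ->
  A <= v -> v <= B -> `|pot m A B v - pot m A B u| <= cdfl m A B * `|v - u|.
Proof.
move=> mAB; wlog uv : u v / u <= v => [H Au uB Av vB|Au uB Av vB].
  have [uv|vu] := leP u v; first exact: H.
  by rewrite distrC (distrC v); apply: H => //; exact: ltW.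
have H1 := pot_slope_ge mAB Au uv vB; have H2 := pot_slope_le mAB Au uv vB.
have M1 : cdfl m A v <= cdfl m A B by apply: (cdfl_le mAB) => //; lra.
have M0 : 0 <= cdfr m A u by exact: fine_ge0.
have uv0 : 0 <= v - u by lra.
rewrite (ger0_norm uv0) ger0_norm; last by apply: le_trans H1; rewrite mulr_ge0.
by apply: le_trans H2 _; rewrite mulrC ler_wpM2r.
Qed.

(* At points where [a' = F], the right derivative of [second_diff (pot m A B) a]
   is [(P - Q) * (a' - F) = 0], where [P], [Q] are the values of [cdfr] at
   [y + a y] and [y - a y]; no almost everywhere argument on atoms is needed. *)
Lemma ode_second_diff_const A B u v : O A -> O B -> u <= v -> J u -> J v ->
  (forall z, u <= z -> z <= v -> A < z - a z /\ z + a z < B) ->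
  second_diff (pot m A B) a u = second_diff (pot m A B) a v.
Proof.
move=> OA OB uv Ju Jv W; have uvJ := cut_segment Ju Jv.
have mAB := speed_like_lty sl OA OB.
set g := second_diff (pot m A B) a.
pose M := cdfl m A B; have M0 : 0 <= M by exact: fine_ge0.
have Juv z : u <= z -> z <= v -> J z.
  by move=> uz zv; apply: uvJ; rewrite /= in_itv/= uz.
have inAB z : u <= z -> z <= v ->
    [/\ A < z - a z, z + a z < B, A < z, z < B & 0 < a z].
  move=> uz zv; have [? ?] := W z uz zv; have := a_gt0 (Juv z uz zv).
  by move=> ?; split => //; lra.
(* [M] is a Lipschitz constant of [pot] on the window; the outer terms of [second_diff] count once
   each and the middle one twice, hence [4 * M]. *)
have g_lip x y : u <= x -> x <= y -> y <= v ->
    `|g y - g x| <= (4 * M) * (`|y - x| + `|a y - a x|).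
  move=> ux xy yv.
  have [x1 x2 x3 x4 x5] : [/\ A < x - a x, x + a x < B, A < x, x < B & 0 < a x].
    by apply: inAB => //; lra.
  have [y1 y2 y3 y4 y5] : [/\ A < y - a y, y + a y < B, A < y, y < B & 0 < a y].
    by apply: inAB => //; lra.
  have L1 : `|pot m A B (y + a y) - pot m A B (x + a x)| <=
      M * (`|y - x| + `|a y - a x|).
    apply: le_trans (pot_lipschitz mAB _ _ _ _) _; try lra.
    rewrite ler_wpM2l// (_ : _ - _ = (y - x) + (a y - a x)); last by ring.
    exact: ler_normD.
  have L2 : `|pot m A B (y - a y) - pot m A B (x - a x)| <=
      M * (`|y - x| + `|a y - a x|).
    apply: le_trans (pot_lipschitz mAB _ _ _ _) _; try lra.
    rewrite ler_wpM2l// (_ : _ - _ = (y - x) - (a y - a x)); last by ring.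
    exact: ler_normB.
  have L3 : `|pot m A B y - pot m A B x| <= M * (`|y - x| + `|a y - a x|).
    apply: le_trans (pot_lipschitz mAB _ _ _ _) _; try lra.
    by rewrite ler_wpM2l// lerDl.
  rewrite /g /second_diff -mulrA; move: L1 L2 L3.
  set T := M * _; rewrite !ler_norml => /andP[? ?] /andP[? ?] /andP[? ?].
  by apply/andP; split; lra.
have M4 : 0 <= 4 * M by rewrite mulr_ge0.
have gac := absolutely_continuous_comp M4 (a_ac uv uvJ) g_lip.
have g_small : {ae (@lebesgue_measure R), forall x, u <= x < v ->
    forall e, 0 < e -> \forall t \near 0^'+, `|g (x + t) - g x| <= e * t}.
  apply: ae_lebesgueS a_ode => x H /andP[ux xv].
  have Jx := Juv x ux (ltW xv); have [dx da] := H Jx.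
  have [x1 x2 x3 x4 x5] := inAB x ux (ltW xv).
  have Ox1 : O (x - a x) by apply: (speed_like_conv sl OA OB); lra.
  have Ox2 : O (x + a x) by apply: (speed_like_conv sl OA OB); lra.
  apply: second_diff_ode dx _.
  - by apply: (right_diff_pot mAB); lra.
  - by apply: (right_diff_pot mAB); lra.
  - by apply: (right_diff_pot mAB); lra.
  - apply: (@lt_le_trans _ _ (cdfl m A (x + a x))).
      by apply: (cdf_strict sl mAB) => //; lra.
    by apply: (cdfl_le_cdfr mAB); lra.
  - exists (v - x); first lra.
    move=> t t0 tv; have Jt : J (x + t) by apply: Juv; lra.
    by have := ode_lipschitz Jx Jt; rewrite addrAC subrr add0r (ger0_norm t0).
  - rewrite da /ode_field asboolT; last by split.
    by apply: (right_slopeE mAB) => //; lra.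
apply/eqP; rewrite eq_le; apply/andP; split.
  apply: ac_dini_nondecreasing => //; apply: ae_lebesgueS g_small => x H uxv e e0.
  apply: filterS (H uxv e e0) => t; rewrite ler_norml => /andP[? _].
  by rewrite mulNr.
rewrite -lerN2; apply: (@ac_dini_nondecreasing R u v (fun z => - g z)) => //.
  move=> e e0; have [del del0 H] := gac e e0; exists del => // n s t st tI sd.
  have := H n s t st tI sd; congr (_ < _); apply: eq_bigr => i _.
  by rewrite -opprD normrN.
apply: ae_lebesgueS g_small => x H uxv e e0.
apply: filterS (H uxv e e0) => t; rewrite ler_norml => /andP[_ ?].
by rewrite mulNr -opprD lerN2.
Qed.

Variable f : R -> R.
Hypothesis Jroot : forall y, J y -> root_of m O h y (f y).

(** The Lipschitz bound keeps the feet of nearby tents of [a] in one window, where all pairs are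
    good. The equation thus persists from [y] to [z], and roots are unique. *)
Lemma ode_root_local y : J y -> a y = f y ->
  exists2 d : R, 0 < d & forall z, `|z - y| <= d -> J z /\ a z = f z.
Proof.
move=> Jy ay; have oJ : open J by exact: ointv_open.
have [f0 O1 O2 Gy] := Jroot Jy; rewrite -ay in f0 O1 O2 Gy.
have [A [B [d1 [OA OB d10 AE BE]]]] := speed_like_window sl O1 O2.
have mAB := speed_like_lty sl OA OB.
have [d2 d20 HJ] := open_window oJ Jy.
pose d := Num.min d1 d2.
have d0 : 0 < d by rewrite lt_min d10 d20.
have dd1 : d <= d1 by rewrite ge_min lexx.
have dd2 : d <= d2 by rewrite ge_min lexx orbT.
have W z : `|z - y| <= d -> [/\ J z, A < z - a z & z + a z < B].
  move=> zd; have Jz : J z by apply: HJ; lra.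
  have := le_trans (ode_lipschitz Jy Jz) zd; move: zd.
  by rewrite !ler_norml => /andP[? ?] /andP[? ?]; split => //; lra.
exists d => // z zd; have [Jz z1 z2] := W z zd; split => //.
have gE : second_diff (pot m A B) a z = second_diff (pot m A B) a y.
  move: zd; rewrite ler_norml => /andP[zd1 zd2].
  have [yz|zy] := leP y z.
    symmetry; apply: ode_second_diff_const => // u yu uz.
    by have [] := W u => //; rewrite ler_norml; apply/andP; split; lra.
  apply: ode_second_diff_const => //; first exact: ltW.
  move=> u zu uy.
  by have [] := W u => //; rewrite ler_norml; apply/andP; split; lra.
have az0 := a_gt0 Jz.
apply: (root_of_unique sl _ (Jroot Jz)); split => //.
- by apply: (speed_like_conv sl OA OB); lra.
- by apply: (speed_like_conv sl OA OB); lra.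
have GE u : 0 < a u -> A <= u - a u -> u + a u <= B ->
    tent_integral m u (a u) = (second_diff (pot m A B) a u / 2)%:E.
  by move=> u0 u1 u2; rewrite (tent_integral_pot mAB)// ltW.
by move: Gy; rewrite (GE y) ?(GE z) ?gE//; lra.
Qed.

Lemma ode_unique y0 y : J y0 -> a y0 = f y0 -> J y -> a y = f y.
Proof.
move=> Jy0 ay0 Jy; have oJ : open J by exact: ointv_open.
have cJ : connected J by apply/connected_intervalP; exact: ointv_is_interval.
pose E := [set z | J z /\ a z = f z].
suff : E = J by move=> EJ; have : E y by [rewrite EJ]; case.
apply: cJ; first by exists y0.
  exists E; last by apply/seteqP; split => [z [Jz az]|z [_ Ez]].
  rewrite openE => z [Jz az]; have [d d0 H] := ode_root_local Jz az.
  apply/nbhs_ballP; exists d => //= u; rewrite /ball/= distrC => /ltW ud.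
  exact: H.
exists (closure E); first exact: closed_closure.
apply/seteqP; split => [z Ez|z [Jz cE]].
  by split; [case: Ez|exact: subset_closure].
split => //; apply: contrapT => ne.
(* A coincidence point [u] within [e] of [z] forces [|a z - f z| < 2 * e] by the two Lipschitz
   bounds, against [3 * e]. *)
pose e : R := `|a z - f z| / 3.
have e0 : 0 < e by rewrite divr_gt0// normr_gt0 subr_eq0; apply/eqP.
have [u [[Ju au]]] := cE _ (nbhsx_ballx z e e0).
rewrite /ball/= => zu.
have := ode_lipschitz Ju Jz; have := level_lipschitz sl Jroot Ju Jz.
rewrite au => H1 H2.
have : `|a z - f z| <= `|z - u| + `|z - u|.
  rewrite (_ : a z - f z = (a z - f u) - (f z - f u)); last by ring.
  by apply: le_trans (ler_normB _ _) _; apply: lerD.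
have : 3 * e = `|a z - f z| by rewrite /e mulrC divfK.
by move: zu; lra.
Qed.

End ode_uniqueness.

Theorem theorem2p14 (R : realType) (d : measure_display)
    (Omega : measurableType d) (l r : \bar R) (I : set R)
    (P : R -> probability Omega R) (Filt : R -> set (set Omega))
    (Y : R -> Omega -> R) (m : {measure set (measurableTypeR R) -> \bar R})
    (hbar h : R)
    (I_interval : state_space l r I)
    (Y_markov : continuous_strong_markov I P Filt Y)
    (Y_regular : regular_process I P Y)
    (Y_natural : natural_scale I P Y)
    (Y_absorbing : absorbing_boundary l r I P Y)
    (m_speed : speed_measure I P Y m)
    (hbar_gt0 : 0 < hbar) (h_gt0 : 0 < h) (h_le : h <= hbar) :
  let J := cut_interval l r m h in
  let a_h := scale_factor I m h in
  ((forall y, J y ->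
      [/\ cvg (right_quotient a_h y e @[e --> 0^'+]),
          cvg (left_quotient a_h y e @[e --> 0^'+]),
          right_derivative a_h y = right_slope m y (a_h y)
        & left_derivative a_h y = left_slope m y (a_h y)]) /\
   cadlag_on J (right_derivative a_h) /\
   caglad_on J (left_derivative a_h) /\
   (forall y, J y ->
      right_derivative a_h (y - e) @[e --> 0^'+] --> left_derivative a_h y) /\
   (exists N : set R, [/\ countable N, N `<=` J
      & forall y, J y -> ~ N y ->
          [/\ derivable a_h y 1,
              derive1 a_h y = right_derivative a_h y
            & derive1 a_h y = left_derivative a_h y]])) /\
  (forall (y0 : R) (a : R -> R),
      J y0 ->
      (forall y, J y -> 0 < a y) ->
      (forall c d : R, c <= d -> `[c, d]%classic `<=` J ->
         absolutely_continuous c d a) ->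
      {ae (@lebesgue_measure R), forall y, J y ->
         derivable a y 1 /\ derive1 a y = ode_field l r I m h y (a y)} ->
      a y0 = a_h y0 ->
      forall y, J y -> a y = a_h y).
Proof.
move=> J a_h; have [lr _ IE] := I_interval.
have sl : speed_like m (interior I).
  split; [exact: open_interior|rewrite IE; exact: ointv_is_interval|].
  by have [+ _] := m_speed.
have oJ : open J by exact: ointv_open.
have Jroot y : J y -> root_of m (interior I) h y (a_h y).
  move=> Jy; have slO : speed_like m (ointv l r) by rewrite -IE.
  have [a [a0 O1 O2 ha]] := cut_interval_exceeds lr h_gt0 slO Jy.
  by apply: (scale_factor_root sl h_gt0 a0); rewrite ?IE.
split.
  split => [y Jy|].
    have rq := level_right_quotient sl oJ Jroot Jy.
    have lq := level_left_quotient sl oJ Jroot Jy.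
    split.
    - by apply/cvg_ex; eexists; exact: rq.
    - by apply/cvg_ex; eexists; exact: lq.
    - exact: (level_right_derivative sl oJ Jroot).
    - exact: (level_left_derivative sl oJ Jroot).
  split; first exact: (level_cadlag sl oJ Jroot).
  split; first exact: (level_caglad sl oJ Jroot).
  split; first exact: (level_right_derivative_left_limit sl oJ Jroot).
  exact: (level_derivable sl oJ Jroot).
move=> y0 a Jy0 a_gt0 a_ac a_ode ay0 y Jy.
exact: (ode_unique sl a_gt0 a_ac a_ode Jroot Jy0 ay0 Jy).
Qed.
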